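(* Let $k\geq 2$ be an integer and let $G=(G_n)_{n\geq 1}$ be a sequence of connected graphs that satisfies the basic conditions for $k$ (defined in the context). Let $(\lambda_n)_{n\ge 1}$ be a sequence of real numbers with $\lambda_n\rightarrow \lambda$ as $n\rightarrow\infty$, where $\lambda>0$. For all sufficiently large $n$, let $p=p(n)\in(0,1)$ be chosen such that $\mathbb{E}[X_n]=\lambda_n$, where $X_n$ is the number of isolated vertices of the random graph $(G_n)_p$. Then $$\lim_{n\rightarrow \infty}\mathbb{P}[(G_n)_p \text{ is connected}]=\exp(-\lambda).$$
   Context: All graphs are finite and simple. For a graph $H$ and $p\in(0,1)$, $H_p$ denotes the random graph on the vertex set of $H$ obtained from $H$ by deleting every edge independently with probability $1-p$. An isolated vertex is a vertex of degree $0$. In particular $\mathbb{E}[X_n]=\sum_{v\in V(G_n)}(1-p)^{d_{G_n}(v)}$, where $d_{G_n}(v)$ is the degree of $v$ in $G_n$. For a graph $H$, let $n(H)$ be its number of vertices, and $\delta(H)$ and $\Delta(H)$ its minimum and maximum degree. For $S\subseteq V(H)$, let $b_H(S)$ be the number of edges of $H$ joining $S$ and its complement $V(H)\setminus S$, and let $b_H(s)=\min_{S\subseteq V(H),\,|S|=s}b_H(S)$. A sequence $G=(G_n)_{n\geq 1}$ of connected graphs satisfies the basic conditions for an integer $k\geq 2$ if there are constants $\epsilon'=\epsilon'(G)>0$, $c=c(G)\in\mathbb{N}$ and $\epsilon=\epsilon(G)>0$ (independent of $n$) such that for all sufficiently large $n$: (1) $n(G_n)=k^n$; (2) $\delta(G_n)\geq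 n$; (3) $\frac{\Delta(G_n)}{\delta(G_n)}\leq n^{1-\epsilon'}$; (4) $\Delta(G_n)\leq n^{c}$; (5) for all integers $s$ with $n^{1-\epsilon'}\leq s\leq k^n/2$: $b_{G_n}(s)\geq \epsilon\, \Delta(G_n)\, s\left(1-\frac{1}{n}\log_k s\right)$. *)

(* Defs.v *)
From HB Require Import structures.
From mathcomp Require Import all_boot all_order all_algebra.
From mathcomp Require Import all_classical all_reals all_analysis.
Import Order.TTheory GRing.Theory Num.Theory.
Import numFieldNormedType.Exports.

Set Implicit Arguments.
Unset Strict Implicit.
Unset Printing Implicit Defensive.

Local Open Scope ring_scope.

Record sgraph := SGraph {
  vertex :> finType;
  adj : rel vertex;
  adj_sym : symmetric adj;
  adj_irrefl : irreflexive adj }.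

Section Graph.
Variable H : sgraph.

(* The graph without vertices counts as connected here; a graph with k ^ n
   vertices, k >= 2, is never that one. *)
Definition connected_graph : bool := [forall x, forall y, connect (@adj H) x y].

Definition degree (v : H) : nat := #|[set w | adj v w]|.

Definition isolated (v : H) : bool := degree v == 0%N.

Definition num_isolated : nat := #|[set v : H | isolated v]|.

Definition max_degree : nat := (\max_(v : H) degree v)%N.

(* As degree v < #|H|, the neutral element #|H| does not affect the minimum
   unless H has no vertex. *)
Definition min_degree : nat := \big[minn/#|H|]_(v : H) degree v.

Definition edges : {set {set H}} :=
  [set f : {set H} | [exists x, exists y, adj x y && (f == [set x; y])]].

Definition boundary (S : {set H}) : nat :=
  #|[set f in edges | [exists x in S, exists y in ~: S, f == [set x; y]]]|.

(* As boundary S <= #|edges|, the neutral element #|edges| does not affect the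
   minimum unless s > #|H|, when no S has s elements. *)
Definition min_boundary (s : nat) : nat :=
  \big[minn/#|edges|]_(S : {set H} | #|S| == s) boundary S.

Definition keep_adj (F : {set {set H}}) : rel H :=
  [rel x y | adj x y && ([set x; y] \in F)].

Lemma keep_adj_sym F : symmetric (keep_adj F).
Proof. by move=> x y; rewrite /keep_adj /= adj_sym finset.setUC. Qed.

Lemma keep_adj_irrefl F : irreflexive (keep_adj F).
Proof. by move=> x; rewrite /keep_adj /= adj_irrefl. Qed.

Definition keep (F : {set {set H}}) : sgraph :=
  SGraph (@keep_adj_sym F) (@keep_adj_irrefl F).

Variable R : realType.

(* The probability that F is exactly the set of surviving edges. *)
Definition edge_weight (p : R) (F : {set {set H}}) : R :=
  \prod_(f in edges) (if f \in F then p else 1 - p).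

(* The law of the random graph H_p: probability that it satisfies A, and
   expectation of X at it. *)
Definition rgraph_prob (p : R) (A : pred sgraph) : R :=
  \sum_(F in powerset edges | A (keep F)) edge_weight p F.

Definition rgraph_expect (p : R) (X : sgraph -> R) : R :=
  \sum_(F in powerset edges) edge_weight p F * X (keep F).

End Graph.

Section BasicConditions.
Local Open Scope classical_set_scope.
Local Open Scope ring_scope.
Variables (R : realType) (k : nat) (G : nat -> sgraph).

(* Only the eventual behaviour of G matters, so that G 0 is irrelevant. *)
Definition basic_conditions : Prop :=
  exists (eps' : R) (c : nat) (eps : R),
    [/\ 0 < eps', 0 < eps &
      \forall n \near \oo,
        [/\ #|G n| = (k ^ n)%N,
            (n <= min_degree (G n))%N,
            (max_degree (G n))%:R / (min_degree (G n))%:R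
              <= (n%:R : R) `^ (1 - eps'),
            (max_degree (G n) <= n ^ c)%N &
            forall s : nat,
              (n%:R : R) `^ (1 - eps') <= s%:R ->
              s%:R <= (k%:R ^+ n / 2 : R) ->
              eps * (max_degree (G n))%:R * s%:R
                  * (1 - n%:R^-1 * (ln s%:R / ln k%:R))
                <= (min_boundary (G n) s)%:R]].

End BasicConditions.

(* Main.v *)
From Pilot Require Import Defs.
From mathcomp Require Import all_boot all_order all_algebra.
From mathcomp Require Import all_classical all_reals all_analysis.
From mathcomp Require Import zify ring lra.
Import Order.TTheory GRing.Theory Num.Theory.
Import numFieldNormedType.Exports.

Set Implicit Arguments.
Unset Strict Implicit.
Unset Printing Implicit Defensive.

Local Open Scope classical_set_scope.
Local Open Scope ring_scope.

(** Write [q = 1 - p = exp (- a)], [N = k ^ n], and [delta], [Delta] for the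
    extreme degrees of [G_n]. Since [N q ^ Delta <= E X <= lambda + 1] for large
    [n], [a Delta >= ln N / 2]; as [Delta / delta <= n ^ (1 - eps')], it follows
    that [q ^ delta] is smaller than every power of [1 / n], hence than every
    power of [1 / Delta].

    The number of isolated vertices is asymptotically Poisson at [0]:
    [P (no isolated vertex)] tends to [exp (- lambda)]. The lower bound
    [prob_no_isolated_ge] is the Harris inequality, and the upper bound
    [prob_no_isolated_le] is Janson's argument; both are sharp in the limit
    because the probabilities [q ^ d(v)] are small and two vertices interact only
    if they are adjacent.

    It remains to see that a component with [s] vertices, [2 <= s <= N / 2], is
    unlikely to exist. Such a component is visited by a walk of length
    [2 (s - 1)] and all its boundary edges are missing, so that a given vertex
    lies in one with probability at most [Delta ^ (2 (s - 1)) q ^ b(s)]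
    ([prob_comp_size]). There are three ranges.

    - For [s < n ^ (1 - eps')] (with [eps' <= 1 / 2] without loss of generality)
      almost all edges at a vertex of [S] leave [S], and
      the bound is at most [q ^ d(v)] times a high power of [1 / n]
      ([small_comp_prob]).
    - For [n ^ (1 - eps') <= s < M := N / n ^ C] the isoperimetric condition
      gives [q ^ b(s) <= (s / N) ^ (eps s / 2)]. This beats [Delta ^ (2 s)] if [C]
      is large, and the bound is at most [N ^ (-3)] ([mid_comp_prob]).
    - For [s >= M] there are too many connected sets for a union bound. The
      random graph is exposed in two rounds instead, each missing an edge with
      probability [sqrt q]. The previous two estimates hold for the first round
      too, up to constants, and show that it has at most [B := M / n] components,
      except with probability [O (1 / n)]. Only the [2 ^ B] unions of these can be
      unions of components in the end, and the second round separates each of them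
      with probability at most [2 ^ (- eps M / 4)] ([prob_separated_le]).

    The theorem [prob_connected_estimate] combines everything into an explicit
    two-sided bound for one graph, whose two sides have the same limit. *)

(** * Random subsets *)

Section RandomSubset.
Import mathcomp.boot.fintype mathcomp.boot.finset.
Local Close Scope classical_set_scope.

Variables (R : realDomainType) (T : finType).
Implicit Types (p : R) (E F B : {set T}) (f g : {set T} -> R).

Lemma set_add_ind (P : {set T} -> Prop) :
  P set0 -> (forall e E, e \notin E -> P E -> P (e |: E)) -> forall E, P E.
Proof.
move=> P0 PU E; have [n] := ubnP #|E|; elim: n E => // n IH E leEn.
have [-> //|[e eE]] := set_0Vmem E.
rewrite -(setD1K eE); apply: PU; first by rewrite !inE eqxx.
by apply: IH; move: leEn; rewrite (cardsD1 e) eE.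
Qed.

Definition expect p E f : R :=
  \sum_(F in powerset E) (\prod_(e in E) (if e \in F then p else 1 - p)) * f F.

Lemma expect_set0 p f : expect p set0 f = f set0.
Proof. by rewrite /expect powerset0 big_set1 big_set0 mul1r. Qed.

(** Conditioning on whether [e] is chosen. Every later fact about [expect] is
    proved with this recursion, by adding the elements of [E] one at a time. *)
Lemma expect_setU1 p e E f : e \notin E ->
  expect p (e |: E) f =
  p * expect p E (fun F => f (e |: F)) + (1 - p) * expect p E f.
Proof.
move=> eE; have prodE F : \prod_(x in e |: E) (if x \in F then p else 1 - p) =
    (if e \in F then p else 1 - p) *
    \prod_(x in E) (if x \in F then p else 1 - p) by rewrite big_setU1.
rewrite /expect (bigID (fun F => e \in F)) /= !big_distrr /=; congr (_ + _).
  rewrite (reindex_onto (fun F => e |: F) (fun F => F :\ e)) /=; last first.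
    by move=> F /andP[_ /setD1K].
  apply: eq_big => [F|F].
    rewrite !powersetE setU11 andbT; apply/andP/idP.
      by move=> [sFE /eqP defF]; rewrite -defF subDset.
    move=> sFE; have eF : e \notin F by apply: contra eE; apply: (subsetP sFE).
    by rewrite setUS // setU1K.
  move=> /andP[_ /eqP defF]; rewrite prodE setU11 -mulrA; congr (_ * (_ * _)).
  apply: eq_bigr => x xE; rewrite in_setU1.
  by case: eqP => // xe; rewrite -xe xE in eE.
apply: eq_big => [F|F].
  rewrite !powersetE; apply/andP/idP.
    move=> [/subsetP sFE eF]; apply/subsetP => x xF.
    by have := sFE _ xF; rewrite in_setU1; case: eqP => // xe; rewrite -xe xF in eF.
  move=> sFE; split; first exact: subset_trans sFE (subsetU1 _ _).
  by apply: contra eE; apply: (subsetP sFE).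
by move=> /andP[_ /negbTE eF]; rewrite prodE eF mulrA.
Qed.

Lemma eq_expect p E f g :
  (forall F, F \subset E -> f F = g F) -> expect p E f = expect p E g.
Proof.
by move=> eqfg; apply: eq_bigr => F; rewrite powersetE => sFE; rewrite eqfg.
Qed.

Lemma expectD p E f g :
  expect p E (fun F => f F + g F) = expect p E f + expect p E g.
Proof. by rewrite -big_split; apply: eq_bigr => F _; rewrite mulrDr. Qed.

Lemma expectZ p E (c : R) f :
  expect p E (fun F => c * f F) = c * expect p E f.
Proof. by rewrite big_distrr; apply: eq_bigr => F _; rewrite mulrCA. Qed.

Lemma expectN p E f : expect p E (fun F => - f F) = - expect p E f.
Proof. by rewrite -sumrN; apply: eq_bigr => F _; rewrite mulrN. Qed.

Lemma expect_sum p E (I : Type) (r : seq I) (P : pred I) (h : I -> {set T} -> R) :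
  expect p E (fun F => \sum_(i <- r | P i) h i F) =
  \sum_(i <- r | P i) expect p E (h i).
Proof. by rewrite exchange_big; apply: eq_bigr => F _; rewrite big_distrr. Qed.

Lemma expect_cst p E (c : R) : expect p E (fun=> c) = c.
Proof.
elim/set_add_ind: E => [|e E eE IH]; first exact: expect_set0.
by rewrite expect_setU1 // IH -mulrDl addrC subrK mul1r.
Qed.

Section Monotone.
Variables (p : R) (p01 : 0 <= p <= 1).

Let p_ge0 : 0 <= p. Proof. by case/andP: p01. Qed.
Let q_ge0 : 0 <= 1 - p. Proof. by rewrite subr_ge0; case/andP: p01. Qed.

Lemma le_expect E f g :
  (forall F, F \subset E -> f F <= g F) -> expect p E f <= expect p E g.
Proof.
move=> lefg; apply: ler_sum => F; rewrite powersetE => sFE.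
by apply: ler_wpM2l; [apply: prodr_ge0 => e _; case: ifP | apply: lefg].
Qed.

Lemma expect_ge0 E f : (forall F, 0 <= f F) -> 0 <= expect p E f.
Proof. by move=> f0; rewrite -(expect_cst p E 0); apply: le_expect. Qed.

Definition increasing f := forall F F', F \subset F' -> f F <= f F'.

(** The Harris inequality: increasing functions are positively correlated. If
    [x1 >= x0] and [y1 >= y0] are the conditional expectations of [f] and [g]
    given that an element is chosen or not, then [E[fg] - E[f]E[g]] gains the
    term [p (1 - p) (x1 - x0) (y1 - y0) >= 0] when the element is added. *)
Lemma harris E f g : increasing f -> increasing g ->
  expect p E f * expect p E g <= expect p E (fun F => f F * g F).
Proof.
elim/set_add_ind: E f g => [|e E eE IH] f g incf incg.
  by rewrite !expect_set0.
have incU h : increasing h -> increasing (fun F => h (e |: F)).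
  by move=> inch F F' sFF'; apply: inch; apply: setUS.
have mono h : increasing h -> expect p E h <= expect p E (fun F => h (e |: F)).
  by move=> inch; apply: le_expect => F _; apply: inch; apply: subsetUr.
rewrite !expect_setU1 //.
have h1 := IH _ _ (incU _ incf) (incU _ incg).
have h0 := IH _ _ incf incg.
have := mono _ incf; have := mono _ incg.
move: h0 h1.
move: (expect p E f) (expect p E g) => x0 y0.
move: (expect p E (fun F => f (e |: F))) => x1.
move: (expect p E (fun F => g (e |: F))) => y1.
move: (expect _ _ _) (expect _ _ _) => z0 z1.
move=> h0 h1 ley lex.
apply: (@le_trans _ _ (p * (x1 * y1) + (1 - p) * (x0 * y0))); last first.
  by apply: lerD; apply: ler_wpM2l.
rewrite -subr_ge0.
have -> : p * (x1 * y1) + (1 - p) * (x0 * y0) -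
    (p * x1 + (1 - p) * x0) * (p * y1 + (1 - p) * y0) =
    p * (1 - p) * ((x1 - x0) * (y1 - y0)) by ring.
by rewrite !mulr_ge0 // subr_ge0.
Qed.

Lemma harris_prod E (I : Type) (r : seq I) (h : I -> {set T} -> R) :
  (forall i F, 0 <= h i F) -> (forall i, increasing (h i)) ->
  \prod_(i <- r) expect p E (h i) <= expect p E (fun F => \prod_(i <- r) h i F).
Proof.
move=> h0 inch; elim: r => [|i r IH].
  rewrite big_nil -[X in X <= _](expect_cst p E 1).
  by apply: le_expect => F _; rewrite big_nil.
rewrite big_cons; apply: le_trans (_ : _ <= expect p E (h i) * _) _.
  by apply: ler_wpM2l IH; apply: expect_ge0.
apply: le_trans (harris _ _ _) _ => //.
  move=> F F' sFF'; apply: ler_prod => j _.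
  by rewrite h0 /=; apply: inch.
by apply: le_expect => F _; rewrite big_cons.
Qed.

End Monotone.

(** A function that ignores the elements of [B] is independent of the event
    that no element of [B] is chosen. *)
Lemma expect_disjoint p E B g :
    (forall F F', F :\: B = F' :\: B -> g F = g F') ->
  expect p E (fun F => [disjoint B & F]%:R * g F) =
  (1 - p) ^+ #|B :&: E| * expect p E g.
Proof.
elim/set_add_ind: E g => [|e E eE IH] g gB.
  by rewrite !expect_set0 setI0 cards0 expr0 -setI_eq0 setI0 eqxx.
have gU : forall F F', F :\: B = F' :\: B -> g (e |: F) = g (e |: F').
  by move=> F F' eqF; apply: gB; rewrite !setDUl eqF.
rewrite !expect_setU1 // IH //.
have [eB|eB] := boolP (e \in B).
  have -> : expect p E (fun F => [disjoint B & e |: F]%:R * g (e |: F)) = 0.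
    rewrite -[RHS](expect_cst p E 0); apply: eq_expect => F _.
    rewrite -setI_eq0 (_ : _ == set0 = false) ?mul0r //.
    by apply/negbTE/set0Pn; exists e; rewrite !inE eB eqxx.
  have -> : expect p E (fun F => g (e |: F)) = expect p E g.
    apply: eq_expect => F _; apply: gB; apply/setP=> x; rewrite !inE.
    by case: eqP => [->|//]; rewrite eB.
  have -> : B :&: (e |: E) = e |: (B :&: E).
    by rewrite setIUr (setIidPr _) ?sub1set.
  rewrite cardsU1 inE (negbTE eE) andbF /= exprS; ring.
have -> : B :&: (e |: E) = B :&: E.
  rewrite setIUr (_ : B :&: [set e] = set0) ?set0U //.
  by apply/setP => x; rewrite !inE; case: eqP => [->|]; rewrite ?(negbTE eB) ?andbF.
have -> : expect p E (fun F => [disjoint B & e |: F]%:R * g (e |: F)) =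
    expect p E (fun F => [disjoint B & F]%:R * g (e |: F)).
  apply: eq_expect => F _; congr (_%:R * _).
  rewrite -!setI_eq0 setIUr (_ : B :&: [set e] = set0) ?set0U //.
  by apply/setP => x; rewrite !inE; case: eqP => [->|]; rewrite ?(negbTE eB) ?andbF.
rewrite (IH _ gU); ring.
Qed.

Lemma prob_disjoint p E B : B \subset E ->
  expect p E (fun F => [disjoint B & F]%:R) = (1 - p) ^+ #|B|.
Proof.
move=> sBE; have := @expect_disjoint p E B (fun=> 1) (fun _ _ _ => erefl).
rewrite expect_cst mulr1 (setIidPl sBE) => <-.
by apply: eq_expect => F _; rewrite mulr1.
Qed.

(** The union of independent random subsets is again a random subset, in which
    an element is missing exactly when it is missing from both. *)
Lemma expect_setU p p1 p2 E f : 1 - p = (1 - p1) * (1 - p2) ->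
  expect p E f = expect p1 E (fun F1 => expect p2 E (fun F2 => f (F1 :|: F2))).
Proof.
move=> pE; elim/set_add_ind: E f => [|e E eE IH] f.
  by rewrite !expect_set0 setU0.
rewrite !expect_setU1 // !IH.
have -> : expect p1 E (fun F1 =>
      expect p2 (e |: E) (fun F2 => f ((e |: F1) :|: F2))) =
    expect p1 E (fun F1 => expect p2 E (fun F2 => f (e |: (F1 :|: F2)))).
  apply: eq_expect => F1 _; rewrite expect_setU1 //.
  have -> : expect p2 E (fun F2 => f ((e |: F1) :|: (e |: F2))) =
      expect p2 E (fun F2 => f (e |: (F1 :|: F2))).
    by apply: eq_expect => F2 _; rewrite setUACA setUid.
  have -> : expect p2 E (fun F2 => f ((e |: F1) :|: F2)) =
      expect p2 E (fun F2 => f (e |: (F1 :|: F2))).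
    by apply: eq_expect => F2 _; rewrite setUA.
  ring.
have -> : expect p1 E (fun F1 => expect p2 (e |: E) (fun F2 => f (F1 :|: F2))) =
    p2 * expect p1 E (fun F1 => expect p2 E (fun F2 => f (e |: (F1 :|: F2)))) +
    (1 - p2) * expect p1 E (fun F1 => expect p2 E (fun F2 => f (F1 :|: F2))).
  rewrite -!expectZ -expectD; apply: eq_expect => F1 _.
  rewrite expect_setU1 //; congr (_ * _ + _).
  by apply: eq_expect => F2 _; rewrite setUCA.
have -> : p = 1 - (1 - p1) * (1 - p2) by rewrite -pE; ring.
ring.
Qed.

End RandomSubset.

(** * Isolated vertices *)

Section Isolated.
(* The names of finite sets and of [isolated] are also those of set-theoretic
   and topological notions, which are not meant here. *)
Import mathcomp.boot.fintype mathcomp.boot.finset Pilot.Defs.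
Local Close Scope classical_set_scope.

Variables (R : realType) (H : sgraph).
Implicit Types (p : R) (F : {set {set H}}) (S : {set H}) (u v w x y : H).

Lemma rgraph_probE p (A : pred sgraph) :
  rgraph_prob H p A = expect p (edges H) (fun F => (A (keep F))%:R).
Proof.
rewrite /rgraph_prob big_mkcondr; apply: eq_bigr => F _.
by case: (A _); rewrite ?mulr1 ?mulr0.
Qed.

Lemma mem_edges x y : ([set x; y] \in edges H) = adj x y.
Proof.
rewrite inE; apply/existsP/idP => [[x' /existsP[y' /andP[xy' /eqP eq_xy]]]|xy].
  have neq : x' != y' by apply: contraTneq xy' => ->; rewrite adj_irrefl.
  have := set21 x' y'; have := set22 x' y'; rewrite -eq_xy !inE.
  move=> /orP[] /eqP y'E /orP[] /eqP x'E; move: xy' neq;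
    rewrite x'E y'E ?eqxx // => xy' _; by rewrite // adj_sym.
by exists x; apply/existsP; exists y; rewrite xy eqxx.
Qed.

Lemma edgesP f :
  reflect (exists x y, adj x y /\ f = [set x; y]) (f \in edges H).
Proof.
apply: (iffP idP) => [|[x [y [xy ->]]]]; last by rewrite mem_edges.
rewrite inE => /existsP[x /existsP[y /andP[xy /eqP ->]]].
by exists x, y.
Qed.

Lemma adj_neq x y : adj x y -> x != y.
Proof. by apply: contraTneq => ->; rewrite adj_irrefl. Qed.

Definition star v : {set {set H}} := [set f in edges H | v \in f].

Lemma star_sub v : star v \subset edges H.
Proof. by apply/subsetP => f; rewrite inE => /andP[]. Qed.

Lemma mem_star v w f : f \in star v -> w \in f -> w != v ->
  adj v w /\ f = [set v; w].
Proof.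
rewrite inE => /andP[/edgesP[x [y [xy ->]]]]; rewrite !inE.
move=> /orP[] /eqP vE /orP[] /eqP wE; rewrite vE wE ?eqxx //.
by rewrite adj_sym setUC.
Qed.

Lemma starE v : star v = [set [set v; w] | w in [set w | adj v w]].
Proof.
apply/setP => f; apply/idP/imsetP => [fv|[w]].
  have /edgesP[x [y [xy fE]]] := subsetP (star_sub v) f fv.
  have [w wf wv] : exists2 w, w \in f & w != v.
    have [xv|xv] := eqVneq x v; last by exists x; rewrite // fE set21.
    by exists y; rewrite ?fE ?set22 // -xv eq_sym; apply: adj_neq.
  by have [vw ->] := mem_star fv wf wv; exists w; rewrite ?inE.
by rewrite inE => vw ->; rewrite inE mem_edges vw set21.
Qed.

Lemma card_star v : #|star v| = degree v.
Proof.
rewrite starE card_in_imset // => x y; rewrite !inE => vx vy eqf.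
have := set22 v x; rewrite eqf !inE => /orP[/eqP xv|/eqP //].
by rewrite xv adj_irrefl in vx.
Qed.

Lemma isolated_keep F v :
  isolated (v : keep F) = [disjoint star v & F].
Proof.
rewrite /isolated /degree cards_eq0 -setI_eq0 starE.
apply/eqP/eqP => [D|D]; apply/setP => x; rewrite !inE.
  apply/negbTE/negP => /andP[/imsetP[w]]; rewrite inE => vw -> wF.
  have : w \in [set w : keep F | @adj (keep F) v w].
    by rewrite inE; apply/andP.
  by rewrite D inE.
apply/negbTE/negP => /= /andP[vx xF].
have : [set v; x] \in [set [set v; w] | w in [set w | adj v w]] :&: F.
  by rewrite inE xF andbT; apply/imsetP; exists x; rewrite ?inE.
by rewrite D inE.
Qed.

Lemma expect_num_isolated p :
  rgraph_expect H p (fun K => (num_isolated K)%:R) =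
  \sum_(v : H) (1 - p) ^+ degree v.
Proof.
have -> : rgraph_expect H p (fun K => (num_isolated K)%:R) =
    expect p (edges H) (fun F => (num_isolated (keep F))%:R) by [].
have -> : \sum_(v : H) (1 - p) ^+ degree v =
    \sum_(v : H) expect p (edges H) (fun F => [disjoint star v & F]%:R).
  by apply: eq_bigr => v _; rewrite prob_disjoint ?star_sub // card_star.
rewrite -expect_sum; apply: eq_expect => F _.
rewrite /num_isolated -sum1dep_card natr_sum big_mkcond /=.
by apply: eq_bigr => v _; rewrite -isolated_keep; case: isolated.
Qed.

Definition no_isolated : pred sgraph :=
  fun K => [forall v : K, ~~ isolated v].

Lemma no_isolatedE F : (no_isolated (keep F))%:R =
  \prod_(v : H) (1 - [disjoint star v & F]%:R) :> R.
Proof.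
have [/forallP noF|] := boolP (no_isolated (keep F)).
  by rewrite big1 // => v _; rewrite -isolated_keep (negbTE (noF v)) subr0.
rewrite negb_forall => /existsP[v]; rewrite negbK => iso_v.
by rewrite (bigD1 v) //= -isolated_keep iso_v subrr mul0r.
Qed.

Lemma disjoint_antitone (B : {set {set H}}) :
  increasing (fun F => 1 - [disjoint B & F]%:R : R).
Proof.
move=> F F' sFF'; rewrite lerD2l lerN2 ler_nat.
have [/(disjointWr sFF') -> //|_] := boolP [disjoint B & F'].
exact: leq0n.
Qed.

Lemma bigminn_le (I : eqType) (r : seq I) (P : pred I) (h : I -> nat) a i :
  i \in r -> P i -> (\big[minn/a]_(j <- r | P j) h j <= h i)%N.
Proof.
elim: r => // j r IH; rewrite inE big_cons => /orP[/eqP <- ->|ir Pi].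
  exact: geq_minl.
case: (P j); last exact: IH.
exact: leq_trans (geq_minr _ _) (IH ir Pi).
Qed.

Lemma min_degree_le v : (min_degree H <= degree v)%N.
Proof. by apply: bigminn_le; rewrite ?mem_index_enum. Qed.

Lemma max_degree_ge v : (degree v <= max_degree H)%N.
Proof. exact: leq_bigmax. Qed.

Lemma disjoint_star u v : u != v -> ~~ adj v u -> [disjoint star u & star v].
Proof.
move=> uv nadj; rewrite -setI_eq0; apply/set0Pn => -[f].
rewrite inE => /andP[fu fv].
have uf : u \in f by move: fu; rewrite inE => /andP[].
by have [vu _] := mem_star fv uf uv; rewrite vu in nadj.
Qed.

(** Two adjacent vertices share one edge, which costs only one factor [q] in the
    probability that both are isolated. *)
Lemma card_star2 u v : u != v ->
  (degree v + degree u <= #|star v :|: star u| + 1)%N.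
Proof.
move=> uv; rewrite -!card_star -cardsUI leq_add2l -(cards1 [set v; u]).
apply/subset_leq_card/subsetP => f; rewrite in_setI => /andP[fv fu].
have uf : u \in f by move: fu; rewrite inE => /andP[].
by have [_ ->] := mem_star fv uf uv; rewrite in_set1.
Qed.

Section Poisson.
Variables (p : R) (p01 : 0 <= p <= 1).
Let q : R := 1 - p.
Let q_ge0 : 0 <= q. Proof. by rewrite subr_ge0; case/andP: p01. Qed.
Let q_le1 : q <= 1. Proof. by rewrite gerBl; case/andP: p01. Qed.

(** By the Harris inequality the vertices avoid isolation at least as likely
    as if they did so independently; and [1 - x >= exp (- x / (1 - x))]. *)
Lemma prob_no_isolated_ge (x : R) : x < 1 ->
    (forall v : H, q ^+ degree v <= x) ->
  expR (- ((\sum_(v : H) q ^+ degree v) / (1 - x))) <=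
  rgraph_prob H p no_isolated.
Proof.
move=> x1 qx; rewrite rgraph_probE.
apply: (@le_trans _ _ (\prod_(v : H)
    expect p (edges H) (fun F => 1 - [disjoint star v & F]%:R))); last first.
  rewrite (eq_expect _ (g := fun F => \prod_(v : H) (1 - [disjoint star v & F]%:R))).
    apply: harris_prod => // [v F|v]; last exact: disjoint_antitone.
    by case: [disjoint _ & _]; rewrite ?subrr ?subr0.
  by move=> F _; rewrite no_isolatedE.
rewrite mulr_suml -sumrN expR_sum; apply: ler_prod => v _.
rewrite expR_ge0 /= expectD expect_cst expectN prob_disjoint ?star_sub //.
rewrite card_star -/q; set y : R := q ^+ _.
have y0 : 0 <= y by rewrite exprn_ge0.
have yx : y <= x := qx v.
have y1 : 0 < 1 - y by rewrite subr_gt0; apply: le_lt_trans x1.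
apply: (@le_trans _ _ (expR (- (y / (1 - y))))).
  rewrite ler_expR lerN2 ler_wpM2l // lef_pV2 ?posrE ?subr_gt0 //.
    by rewrite lerD2l lerN2.
  exact: le_lt_trans x1.
rewrite expRN -[leRHS]invrK lef_pV2 ?posrE ?invr_gt0 ?expR_gt0 //.
apply: le_trans (expR_ge1Dx _).
suff <- : (1 - y)^-1 = 1 + y / (1 - y) by [].
by field; apply: lt0r_neq0.
Qed.

(** Janson's argument: let [D] be the event that no vertex among those already
    considered and not adjacent to [v] is isolated. It is independent of the
    isolation of [v], and by the Harris inequality it does not make the joint
    isolation of [v] and a neighbour more likely. *)
Lemma prob_no_isolated_le (eta : R) :
    (max_degree H)%:R * q ^+ (min_degree H).-1 <= eta -> eta <= 1 ->
  rgraph_prob H p no_isolated <=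
  expR (- ((1 - eta) * \sum_(v : H) q ^+ degree v)).
Proof.
move=> etaP eta1; rewrite rgraph_probE.
rewrite (eq_expect _ (g := fun F => \prod_(v : H) (1 - [disjoint star v & F]%:R)));
  last by move=> F _; rewrite no_isolatedE.
have I01 v F : 0 <= ([disjoint star v & F]%:R : R) <= 1.
  by rewrite ler0n lern1 leq_b1.
have J01 v F : 0 <= (1 - [disjoint star v & F]%:R : R) <= 1.
  by have := I01 v F; case: [disjoint _ & _]; rewrite ?subrr ?subr0 ?lexx ?ler01.
(* The factor [eta] of the error term comes from here: [v] has at most
   [max_degree H] neighbours [u], each contributing a factor [q ^ (delta - 1)]. *)
have pair u v : adj v u ->
    expect p (edges H) (fun F => [disjoint star v & F]%:R * [disjoint star u & F]%:R)
    <= q ^+ degree v * q ^+ (min_degree H).-1.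
  move=> vu; have uv : u != v by rewrite eq_sym; apply: adj_neq.
  rewrite (eq_expect _ (g := fun F => [disjoint star v :|: star u & F]%:R)).
    rewrite prob_disjoint ?subUset ?star_sub // -exprD ler_wiXn2l //.
    have du : (0 < degree u)%N.
      by rewrite card_gt0; apply/set0Pn; exists v; rewrite inE adj_sym.
    have := card_star2 uv; have := min_degree_le u; lia.
  move=> F _; rewrite -!setI_eq0 setIUl setU_eq0.
  by case: (_ == _); rewrite ?mul1r ?mul0r.
rewrite mulr_sumr -sumrN expR_sum.
have := index_enum_uniq H; elim: (index_enum H) => [_|v r IH /= /andP[vr ur]].
  rewrite !big_nil (eq_expect _ (g := fun=> 1)) ?expect_cst //.
  by move=> F _; rewrite big_nil.
rewrite big_cons.
(* [C]: no vertex of [r] is isolated; [D]: the same for those not adjacent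
   to [v]. *)
pose C F : R := \prod_(j <- r) (1 - [disjoint star j & F]%:R).
pose D F : R := \prod_(j <- r | ~~ adj v j) (1 - [disjoint star j & F]%:R).
have C_ge0 F : 0 <= C F by apply: prodr_ge0 => j _; case/andP: (J01 j F).
have D_ge0 F : 0 <= D F by apply: prodr_ge0 => j _; case/andP: (J01 j F).
have leCD F : C F <= D F.
  rewrite /C (bigID (adj v)) /= -[leRHS]mul1r; apply: ler_wpM2r; first exact: D_ge0.
  by apply: Num.Theory.prodr_ile1 => j _; apply: J01.
have geCD F : D F - \sum_(j <- r | adj v j) [disjoint star j & F]%:R * D F <= C F.
  have -> : C F = \prod_(j <- r | adj v j) (1 - [disjoint star j & F]%:R) * D F.
    by rewrite /C (bigID (adj v)).
  rewrite -mulr_suml.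
  have -> (x : R) : D F - x * D F = (1 - x) * D F by ring.
  apply: ler_wpM2r; first exact: D_ge0.
  (* A product of factors [1 - i] is at least [1] minus the sum of the [i]. *)
  elim: r {IH vr ur C D C_ge0 D_ge0 leCD} => [|j r IH].
    by rewrite !big_nil subr0.
  rewrite !big_cons; case: (adj v j) => //.
  have := I01 j F; have := J01 j F; move: ([disjoint star j & F]%:R : R) => i.
  have : \prod_(j <- r | adj v j) (1 - [disjoint star j & F]%:R) <= 1 :> R.
    by apply: Num.Theory.prodr_ile1 => k _; apply: J01.
  have : 0 <= \prod_(j <- r | adj v j) (1 - [disjoint star j & F]%:R) :> R.
    by apply: prodr_ge0 => k _; case/andP: (J01 k F).
  move: IH; move: (\prod_(_ <- _ | _) _) (\sum_(_ <- _ | _) _) => P S.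
  by nra.
have incD : increasing D.
  move=> F F' sFF'; apply: ler_prod => j _.
  by case/andP: (J01 j F) => -> _; apply: disjoint_antitone.
have indepD : expect p (edges H) (fun F => [disjoint star v & F]%:R * D F) =
    q ^+ degree v * expect p (edges H) D.
  rewrite expect_disjoint => [|F F' eqF].
    by rewrite (setIidPl (star_sub v)) card_star.
  rewrite /D big_seq_cond [RHS]big_seq_cond; apply: eq_bigr => j.
  move=> /andP[jr nadj]; congr (1 - (_ : bool)%:R).
  have jv : j != v by apply: contraNneq vr => <-.
  have sub (K : {set {set H}}) : [disjoint star j & K] = [disjoint star j & K :\: star v].
    rewrite -!setI_eq0 setDE setIA [_ :&: K]setIC -setIA -setDE.
    by rewrite (setDidPl _) 1?setIC // disjoint_star.
  by rewrite sub eqF -sub.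
have harrisD j : expect p (edges H)
    (fun F => [disjoint star v & F]%:R * ([disjoint star j & F]%:R * D F)) <=
    expect p (edges H)
      (fun F => [disjoint star v & F]%:R * [disjoint star j & F]%:R) *
    expect p (edges H) D.
  rewrite -lerN2 -mulNr -!expectN.
  rewrite [leRHS](eq_expect _ (g := fun F =>
    - ([disjoint star v & F]%:R * [disjoint star j & F]%:R) * D F)); last first.
    by move=> F _; rewrite mulrA mulNr.
  apply: harris => // F F' sFF'.
  rewrite lerN2 -!natrM ler_nat.
  have leb (b b' : bool) : (b -> b') -> (b <= b')%N.
    by case: b; case: b' => // /(_ isT).
  by apply: leq_mul; apply: leb; apply: disjointWr.
have ED_ge0 : 0 <= expect p (edges H) D by apply: expect_ge0.
have EC_ge0 : 0 <= expect p (edges H) C by apply: expect_ge0.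
have leECD : expect p (edges H) C <= expect p (edges H) D.
  by apply: le_expect => // F _.
have eta_ge0 : 0 <= 1 - eta by rewrite subr_ge0.
have qd_ge0 : 0 <= q ^+ degree v by rewrite exprn_ge0.
have main : (1 - eta) * q ^+ degree v * expect p (edges H) D <=
    expect p (edges H) (fun F => [disjoint star v & F]%:R * C F).
  apply: (@le_trans _ _ (expect p (edges H) (fun F => [disjoint star v & F]%:R *
    (D F - \sum_(j <- r | adj v j) [disjoint star j & F]%:R * D F)))); last first.
    by apply: le_expect => // F _; apply: ler_wpM2l.
  rewrite [leRHS](eq_expect _ (g := fun F => [disjoint star v & F]%:R * D F +
    - \sum_(j <- r | adj v j)
      [disjoint star v & F]%:R * ([disjoint star j & F]%:R * D F))); last first.
    by move=> F _; rewrite mulrBr mulr_sumr.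
  rewrite expectD expectN expect_sum indepD.
  rewrite -mulrA [(1 - eta) * _]mulrBl mul1r lerD2l lerN2.
  apply: (@le_trans _ _ (\sum_(j <- r | adj v j)
      q ^+ degree v * q ^+ (min_degree H).-1 * expect p (edges H) D)).
    apply: ler_sum => j vj; apply: le_trans (harrisD j) _.
    by apply: ler_wpM2r => //; apply: pair.
  rewrite big_const_seq iter_addr_0 -mulr_natl.
  rewrite !mulrA; apply: ler_wpM2r => //.
  rewrite mulrAC; apply: ler_wpM2r => //.
  apply: le_trans etaP; apply: ler_wpM2r; first exact: exprn_ge0.
  rewrite ler_nat; apply: leq_trans (max_degree_ge v).
  rewrite -size_filter /degree cardE; apply: uniq_leq_size.
    exact: filter_uniq.
  by move=> j; rewrite mem_filter mem_enum inE => /andP[].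
rewrite [leLHS](eq_expect _ (g := fun F => C F + - ([disjoint star v & F]%:R * C F)));
  last by move=> F _; rewrite big_cons mulrBl mul1r.
rewrite expectD expectN; set y := (1 - eta) * q ^+ degree v.
apply: (@le_trans _ _ (expR (- y) * expect p (edges H) C)); last first.
  by apply: ler_wpM2l; rewrite ?expR_ge0 //; apply: IH.
apply: (@le_trans _ _ ((1 - y) * expect p (edges H) C)); last first.
  by apply: ler_wpM2r => //; apply: expR_ge1Dx.
rewrite [leRHS]mulrBl mul1r lerD2l lerN2; apply: le_trans main.
by apply: ler_wpM2l => //; rewrite mulr_ge0.
Qed.

End Poisson.
End Isolated.

(** * Components *)

Section Components.
Import mathcomp.boot.fintype mathcomp.boot.finset Pilot.Defs.
Local Close Scope classical_set_scope.

Variables (R : realType) (H : sgraph).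
Implicit Types (p : R) (F : {set {set H}}) (S : {set H}) (u v w x y : H).

Definition cut S : {set {set H}} :=
  [set f in edges H | [exists x in S, exists y in ~: S, f == [set x; y]]].

Lemma cut_sub S : cut S \subset edges H.
Proof. by apply/subsetP => f; rewrite inE => /andP[]. Qed.

Lemma mem_cut S x y : x \in S -> y \notin S -> adj x y -> [set x; y] \in cut S.
Proof.
move=> xS yS xy; rewrite inE mem_edges xy /=.
by apply/existsP; exists x; rewrite xS; apply/existsP; exists y; rewrite inE yS eqxx.
Qed.

Lemma cutP S f : f \in cut S ->
  exists x y, [/\ x \in S, y \notin S, adj x y & f = [set x; y]].
Proof.
rewrite inE => /andP[fE /existsP[x /andP[xS /existsP[y /andP[yS /eqP fxy]]]]].
by exists x, y; split=> //; [rewrite -in_setC | rewrite -mem_edges -fxy].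
Qed.

(** Inside [S] a vertex has at most [#|S| - 1] neighbours. *)
Lemma boundary_ge S :
  (\sum_(u in S) degree u <= boundary S + #|S| * #|S|.-1)%N.
Proof.
have degE u : u \in S ->
    (degree u <= #|[set w | adj u w & w \notin S]| + #|S|.-1)%N.
  move=> uS; rewrite /degree -(cardsID S) addnC.
  apply: leq_add.
    by apply/subset_leq_card/subsetP => w; rewrite !inE andbC.
  have -> : #|S|.-1 = #|S :\ u| by rewrite (cardsD1 u S) uS.
  apply/subset_leq_card/subsetP => w; rewrite !inE => /andP[uw ->].
  by rewrite andbT eq_sym; apply: adj_neq.
apply: (@leq_trans (\sum_(u in S)
    (#|[set w | adj u w & w \notin S]| + #|S|.-1))).
  by apply: leq_sum.
rewrite big_split /= sum_nat_const leq_add2r.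
pose D := [set a : H * H | [&& a.1 \in S, a.2 \notin S & adj a.1 a.2]].
have -> : (\sum_(u in S) #|[set w | adj u w & w \notin S]|)%N = #|D|.
  rewrite -sum1dep_card (eq_bigl (fun a : H * H => (a.1 \in S) &&
    ((a.2 \notin S) && adj a.1 a.2))) //.
  rewrite -(pair_big_dep _ (fun u w => (w \notin S) && adj u w) (fun _ _ => 1%N)) /=.
  apply: eq_bigr => u _; rewrite sum1dep_card.
  by apply: eq_card => w; rewrite !inE andbC.
have <- : #|[set [set a.1; a.2] | a in D]| = #|D|.
  apply: card_in_imset => -[x y] [x' y'].
  rewrite !inE /= => /and3P[xS yS _] /and3P[x'S y'S _] eqf.
  have := set21 x y; rewrite eqf !inE => /orP[/eqP ->|/eqP xy'].
    have := set22 x y; rewrite eqf !inE => /orP[/eqP yx'|/eqP -> //].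
    by rewrite yx' x'S in yS.
  by rewrite -xy' xS in y'S.
apply/subset_leq_card/subsetP => f /imsetP[[x y]].
by rewrite inE => /and3P[xS yS xy] ->; apply: mem_cut.
Qed.

Definition comp F v : {set H} := [set x | connect (keep_adj F) v x].

Lemma comp_refl F v : v \in comp F v.
Proof. by rewrite inE connect0. Qed.

Lemma keep_connect_sym F : connect_sym (keep_adj F).
Proof. by apply: sym_connect_sym; apply: keep_adj_sym. Qed.

Lemma comp_eq F v x : x \in comp F v -> comp F x = comp F v.
Proof.
rewrite inE => vx; apply/setP => y; rewrite !inE.
by rewrite -(same_connect (@keep_connect_sym F) vx).
Qed.

Lemma closed_cutP F S : reflect (forall x y, keep_adj F x y -> x \in S -> y \in S)
  [disjoint cut S & F].
Proof.
apply: (iffP idP) => [dis x y /andP[xy xyF] xS|cl].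
  apply/negPn/negP => yS.
  by rewrite (disjointFr dis (mem_cut xS yS xy)) in xyF.
rewrite -setI_eq0; apply/set0Pn => -[f]; rewrite inE => /andP[fc fF].
have [x [y [xS yS xy fE]]] := cutP fc.
by rewrite (cl x y) // in yS; rewrite /keep_adj /= xy -fE.
Qed.

Lemma closed_connect F S x y : [disjoint cut S & F] ->
  x \in S -> connect (keep_adj F) x y -> y \in S.
Proof.
move=> /closed_cutP cl xS /connectP[s]; elim: s x xS => [|z s IH] x xS /=.
  by move=> _ ->.
by move=> /andP[xz pz] yE; apply: IH pz yE; apply: cl xz xS.
Qed.

Lemma comp_closed F v : [disjoint cut (comp F v) & F].
Proof.
apply/closed_cutP => x y xy; rewrite !inE => vx.
exact: connect_trans vx (connect1 xy).
Qed.

(** A component with [s] vertices is traversed by a walk with [2 (s - 1)] steps: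
    as long as a vertex is missing, some edge leads from a visited vertex to a
    missing one, and a detour along this edge and back visits it. *)
Lemma comp_walk F v : exists s : seq H,
  [/\ path (keep_adj F) v s, size s = (2 * (#|comp F v|.-1))%N
    & comp F v = [set x in v :: s]].
Proof.
have sub s : path (keep_adj F) v s -> [set x in v :: s] \subset comp F v.
  move=> ps; apply/subsetP => x; rewrite !inE => xs.
  by apply: (path_connect ps); rewrite inE.
suff walk m : (m < #|comp F v|)%N -> exists s,
    [/\ path (keep_adj F) v s, size s = (2 * m)%N & #|[set x in v :: s]| = m.+1].
  have c0 : (0 < #|comp F v|)%N by apply/card_gt0P; exists v; apply: comp_refl.
  have [|s [ps szs cards]] := walk #|comp F v|.-1; first by rewrite prednK.
  exists s; split=> //; apply/esym/eqP.
  by rewrite eqEcard sub // cards prednK /=.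
elim: m => [_|m IH ltm].
  exists [::]; split=> //; rewrite (_ : [set x in [:: v]] = [set v]) ?cards1 //.
  by apply/setP => x; rewrite !inE.
have [s [ps szs cards]] := IH (ltnW ltm).
have [dis|] := boolP [disjoint cut [set x in v :: s] & F].
  have : comp F v \subset [set x in v :: s].
    apply/subsetP => x xc.
    have vx : connect (keep_adj F) v x by move: xc; rewrite inE.
    by apply: (closed_connect dis _ vx); rewrite !inE eqxx.
  by move=> /subset_leq_card; rewrite cards leqNgt ltm.
rewrite -setI_eq0 => /set0Pn[f]; rewrite inE => /andP[/cutP[x [y]]].
rewrite !in_set => -[xs ys xy ->] xyF.
case/splitPl: xs ps szs cards ys => s1 s2 lastx.
rewrite cat_path lastx => /andP[p1 p2] szs cards ys.
exists (s1 ++ y :: x :: s2); split.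
- have kxy : keep_adj F x y by apply/andP.
  by rewrite cat_path lastx p1 /= kxy keep_adj_sym kxy p2.
- by rewrite size_cat /= !addnS -size_cat szs; lia.
- have -> : [set z in v :: s1 ++ y :: x :: s2] = y |: [set z in v :: s1 ++ s2].
    apply/setP => z; rewrite !inE !mem_cat !inE.
    have : z == x -> z \in v :: s1 by move=> /eqP ->; rewrite -lastx mem_last.
    rewrite inE; case: (z == x) (z == v) (z == y) (z \in s1) => [] [] [] [] //=.
    by move=> /(_ isT).
  by rewrite cardsU1 inE ys cards.
Qed.

Fixpoint walks v (l : nat) : seq (seq H) :=
  if l is l'.+1 then
    flatten [seq [seq w :: s | s <- walks w l'] | w <- enum [set w | adj v w]]
  else [:: [::]].

Lemma size_walks v l : (size (walks v l) <= max_degree H ^ l)%N.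
Proof.
elim: l v => // l IH v /=.
rewrite size_flatten /shape -map_comp sumnE big_map expnS.
apply: (@leq_trans (\sum_(w <- enum [set w | adj v w]) max_degree H ^ l)).
  by apply: leq_sum => w _; rewrite /= size_map.
rewrite big_const_seq iter_addn_0 count_predT -cardE mulnC.
by rewrite leq_mul2r orbC max_degree_ge.
Qed.

Lemma mem_walks v s : path (@adj H) v s -> s \in walks v (size s).
Proof.
elim: s v => //= w s IH v /andP[vw ps].
apply/flattenP; exists [seq w :: s | s <- walks w (size s)].
  by apply/mapP; exists w; rewrite // mem_enum inE.
by apply/mapP; exists s; rewrite ?IH.
Qed.

(** Every connected set of size [s] that contains [v] is one of these, by
    [comp_walk]. Sets are indexed by walks because walks are easy to count. *)
Definition walk_sets v (s : nat) : {set {set H}} :=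
  [set S in [seq [set x in v :: l] | l <- walks v (2 * s.-1)] | #|S| == s].

Lemma card_walk_sets v s :
  (#|walk_sets v s| <= max_degree H ^ (2 * s.-1))%N.
Proof.
apply: leq_trans (size_walks v _).
rewrite -(size_map (fun l => [set x in v :: l])).
apply: leq_trans (card_size _); apply/subset_leq_card/subsetP => S.
by rewrite inE => /andP[].
Qed.

Lemma comp_walk_sets F v : comp F v \in walk_sets v #|comp F v|.
Proof.
have [s [ps szs cE]] := comp_walk F v.
rewrite inE eqxx andbT; apply/mapP; exists s => //.
rewrite -szs; apply: mem_walks; apply: sub_path ps.
by move=> x y /andP[].
Qed.

Section Probability.
Variables (p : R) (p01 : 0 <= p <= 1).
Let q_ge0 : 0 <= 1 - p. Proof. by rewrite subr_ge0; case/andP: p01. Qed.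

(** A union bound over the possible vertex sets of the component: the edges that
    leave it are all missing. *)
Lemma prob_comp_size v (s : nat) (t : R) : 0 <= t ->
    (forall S, v \in S -> #|S| = s -> (1 - p) ^+ boundary S <= t) ->
  expect p (edges H) (fun F => (#|comp F v| == s)%:R) <=
  (max_degree H)%:R ^+ (2 * s.-1) * t.
Proof.
move=> t0 bt; pose W := [set S in walk_sets v s | v \in S].
apply: (@le_trans _ _ (\sum_(S in W)
    expect p (edges H) (fun F => [disjoint cut S & F]%:R))).
  rewrite -expect_sum; apply: le_expect => // F _.
  have [cs|_] := eqVneq #|comp F v| s; last exact: sumr_ge0.
  rewrite (bigD1 (comp F v)) /=; last first.
    by rewrite inE -cs comp_walk_sets comp_refl.
  by rewrite comp_closed lerDl sumr_ge0.
apply: (@le_trans _ _ (\sum_(S in W) t)).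
  apply: ler_sum => S; rewrite !inE => /andP[/andP[_ /eqP cS] vS].
  by rewrite prob_disjoint ?cut_sub //; apply: bt.
rewrite sumr_const -[t *+ _]mulr_natl; apply: ler_wpM2r => //.
rewrite -natrX ler_nat; apply: leq_trans (card_walk_sets v s).
by apply/subset_leq_card/subsetP => S; rewrite inE => /andP[].
Qed.

End Probability.

Definition comps F : {set {set H}} := [set comp F v | v : H].

(** A set that no edge of [F] leaves is determined by the components that it
    contains. *)
Lemma card_closed_sets F :
  (#|[set S | [disjoint cut S & F]]| <= 2 ^ #|comps F|)%N.
Proof.
rewrite -card_powerset.
pose h S := [set C in comps F | C \subset S].
have h_inj : {in [set S | [disjoint cut S & F]] &, injective h}.
  have hE S : [disjoint cut S & F] -> S = cover (h S).
    move=> dis; apply/setP => x; apply/idP/bigcupP => [xS|[C]].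
      exists (comp F x); last exact: comp_refl.
      rewrite inE imset_f //=; apply/subsetP => y; rewrite inE.
      exact: closed_connect.
    by rewrite inE => /andP[_ /subsetP]; apply.
  by move=> S S'; rewrite !inE => dS dS' eqh; rewrite (hE S) // (hE S') // eqh.
rewrite -(card_in_imset h_inj); apply/subset_leq_card/subsetP => D /imsetP[S _ ->].
by rewrite powersetE; apply/subsetP => C; rewrite inE => /andP[].
Qed.

(** Each component of size at least [M] accounts for [M] vertices, and each
    smaller one for at least one vertex. *)
Lemma card_comps_le F (M : R) : 0 < M ->
  #|comps F|%:R <= \sum_(v : H) ((#|comp F v|%:R < M)%R%:R + M^-1).
Proof.
move=> M0; rewrite (partition_big (comp F) (fun C => C \in comps F)) /=; last first.
  by move=> v _; apply: imset_f.
rewrite -sum1_card natr_sum; apply: ler_sum => C /imsetP[v0 _ ->].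
rewrite (eq_bigl (fun v => v \in comp F v0)); last first.
  move=> v; apply/eqP/idP => [<-|/comp_eq //]; exact: comp_refl.
rewrite (eq_bigr (fun=> (#|comp F v0|%:R < M)%R%:R + M^-1)); last first.
  by move=> v /comp_eq ->.
rewrite sumr_const -[leRHS]mulr_natl.
have [lt|ge] := ltP (#|comp F v0|%:R) M.
  apply: (@le_trans _ _ (1 * (1 + 0))); first by rewrite addr0 mulr1.
  rewrite ler_pM ?ler01 ?addr0 //.
    by rewrite ler1n; apply/card_gt0P; exists v0; apply: comp_refl.
  by rewrite lerDl invr_ge0 ltW.
by rewrite add0r -ler_pdivrMr ?invr_gt0 // invrK mul1r.
Qed.

Lemma comp_gt1 F v : ~~ isolated (v : keep F) -> (1 < #|comp F v|)%N.
Proof.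
rewrite -lt0n => /card_gt0P[w]; rewrite inE => vw.
rewrite -(cards1 v) [X in (_ < X)%N](cardsD1 v) comp_refl cards1 add1n ltnS.
apply/card_gt0P; exists w; rewrite !inE eq_sym (adj_neq vw) /=.
exact: connect1.
Qed.

Lemma connected_no_isolated F : (1 < #|H|)%N ->
  connected_graph (keep F) -> no_isolated (keep F).
Proof.
move=> H1 /forallP conn; apply/forallP => v.
have [x xv] : exists x : H, x != v.
  have : (0 < #|[set~ v]|)%N by rewrite cardsC1; case: #|_| H1 => [|[]].
  by move=> /card_gt0P[x]; rewrite !inE; exists x.
have /forallP /(_ x) /connectP[[_ xE|w s /= /andP[vw _] _]] := conn v.
  by rewrite xE /= eqxx in xv.
by rewrite -lt0n; apply/card_gt0P; exists w; rewrite inE.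
Qed.

(** If a random subgraph without isolated vertices is disconnected, then its
    smallest component has at least two and at most half of the vertices. *)
Lemma disconnected_cases F (M : R) :
  (no_isolated (keep F))%:R <= (connected_graph (keep F))%:R
    + \sum_(v : H) \sum_(s < #|H|.+1 | [&& (1 < s)%N, (2 * s <= #|H|)%N & s%:R < M])
        (#|comp F v| == s)%:R
    + ([exists S : {set H}, ((M <= #|S|%:R) && (2 * #|S| <= #|H|)%N) &&
        [disjoint cut S & F]])%:R :> R.
Proof.
set A : R := \sum_(v : H) _; set B : R := ([exists S, _])%:R.
have A0 : 0 <= A by do 2! apply: sumr_ge0 => ? _.
have B0 : 0 <= B by [].
have [conn|] := boolP (connected_graph (keep F)).
  rewrite -[leLHS]addr0 -[leLHS]addr0.
  by rewrite !lerD // lern1 leq_b1.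
rewrite negb_forall => /existsP[x]; rewrite negb_forall => /existsP[y xy].
have [/forallP noi|_] := boolP (no_isolated (keep F)); last by rewrite !addr_ge0.
have [v cv] : exists v, (2 * #|comp F v| <= #|H|)%N.
  have : (#|comp F x| + #|comp F y| <= #|H|)%N.
    rewrite -cardsUI (_ : comp F x :&: comp F y = set0) ?cards0 ?addn0 ?max_card //.
    apply/setP => z; rewrite !inE; apply/negbTE; apply: contra xy => /andP[xz yz].
    by apply: connect_trans xz _; rewrite (@keep_connect_sym F).
  move=> le_sum; have [le_xy|/ltnW le_yx] := leqP #|comp F x| #|comp F y|.
    by exists x; rewrite mul2n -addnn; apply: leq_trans le_sum; rewrite leq_add2l.
  by exists y; rewrite mul2n -addnn; apply: leq_trans le_sum; rewrite leq_add2r.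
have c1 := comp_gt1 (noi v).
rewrite add0r; have [ltM|geM] := ltP (#|comp F v|%:R) M; last first.
  rewrite /B (_ : [exists S, _] = true) ?lerDr //.
  by apply/existsP; exists (comp F v); rewrite geM cv comp_closed.
apply: (@le_trans _ _ (A + 0)); last by rewrite lerD2l.
have sN : (#|comp F v| < #|H|.+1)%N by rewrite ltnS max_card.
rewrite addr0 /A (bigD1 v) //= (bigD1 (Ordinal sN)) /=; last by rewrite c1 cv ltM.
by rewrite eqxx -addrA lerDl addr_ge0 // !sumr_ge0 // => *; rewrite sumr_ge0.
Qed.

(** Two independent rounds that together have the law of one round. After the
    first round the number [K] of components is at most [B] except with the
    probability that Markov's inequality gives; then at most [2 ^ B] sets [S]
    are candidates for being separated, and each of them stays separated in the
    second round only if all its boundary edges are missing there. *)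
Lemma prob_separated_le p p1 (B t : R) (P : pred {set H}) :
    0 <= p1 <= 1 -> 1 - p = (1 - p1) * (1 - p1) -> 0 < B -> 0 <= t ->
    (forall S, P S -> (1 - p1) ^+ boundary S <= t) ->
  expect p (edges H) (fun F => [exists S, P S && [disjoint cut S & F]]%:R) <=
  expect p1 (edges H) (fun F => #|comps F|%:R) / B + 2 `^ B * t.
Proof.
move=> p01 pE B0 t0 bt; rewrite (expect_setU _ _ pE).
have -> : expect p1 (edges H) (fun F => #|comps F|%:R) / B + 2 `^ B * t =
    expect p1 (edges H) (fun F => B^-1 * #|comps F|%:R + 2 `^ B * t).
  by rewrite expectD expectZ expect_cst mulrC.
apply: le_expect => // F1 _.
have BK0 : 0 <= B^-1 * #|comps F1|%:R by rewrite mulr_ge0 // invr_ge0 ltW.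
have [ltB|geB] := ltP B (#|comps F1|%:R).
  apply: (@le_trans _ _ 1).
    rewrite -[leRHS](expect_cst p1 (edges H) 1); apply: le_expect => // F _.
    by rewrite lern1 leq_b1.
  rewrite -[leLHS]addr0 lerD //; last by rewrite mulr_ge0 // powR_ge0.
  by rewrite mulrC ler_pdivlMr // mul1r ltW.
rewrite -[leLHS]add0r lerD //.
pose Q := [set S | P S && [disjoint cut S & F1]].
apply: (@le_trans _ _ (\sum_(S in Q)
    expect p1 (edges H) (fun F => [disjoint cut S & F]%:R))).
  rewrite -expect_sum; apply: le_expect => // F2 _.
  case: existsP => [[S /andP[PS]]|_]; last exact: sumr_ge0.
  rewrite -setI_eq0 setIUr setU_eq0 !setI_eq0 => /andP[d1 d2].
  rewrite (bigD1 S) /=; last by rewrite inE PS.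
  by rewrite d2 lerDl sumr_ge0.
apply: (@le_trans _ _ (\sum_(S in Q) t)).
  apply: ler_sum => S; rewrite inE => /andP[PS _].
  by rewrite prob_disjoint ?cut_sub //; apply: bt.
rewrite sumr_const -[t *+ _]mulr_natl; apply: ler_wpM2r; first exact: t0.
apply: (@le_trans _ _ ((2 ^ #|comps F1|)%N%:R)).
  rewrite ler_nat; apply: leq_trans (card_closed_sets F1).
  by apply/subset_leq_card/subsetP => S; rewrite !inE => /andP[].
rewrite natrX -powR_mulrn // ler_powR //.
by rewrite ler1n.
Qed.

Lemma expect_comps_le p (M : R) : 0 <= p <= 1 -> 0 < M ->
  expect p (edges H) (fun F => #|comps F|%:R) <=
  \sum_(v : H) (\sum_(s < #|H|.+1 | (0 < s)%N && (s%:R < M))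
    expect p (edges H) (fun F => (#|comp F v| == s)%:R) + M^-1).
Proof.
move=> p01 M0.
apply: (@le_trans _ _ (expect p (edges H) (fun F =>
    \sum_(v : H) ((#|comp F v|%:R < M)%R%:R + M^-1)))).
  by apply: le_expect => // F _; apply: card_comps_le.
rewrite expect_sum; apply: ler_sum => v _.
rewrite expectD expect_cst lerD2r -expect_sum; apply: le_expect => // F _.
have [ltM|_] := ltP (#|comp F v|%:R) M; last by rewrite sumr_ge0.
have sN : (#|comp F v| < #|H|.+1)%N by rewrite ltnS max_card.
have c0 : (0 < #|comp F v|)%N by apply/card_gt0P; exists v; apply: comp_refl.
rewrite (bigD1 (Ordinal sN)) /=; last by rewrite c0 ltM.
by rewrite eqxx lerDl sumr_ge0.
Qed.

Lemma prob_connected_le p : 0 <= p <= 1 -> (1 < #|H|)%N ->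
  rgraph_prob H p connected_graph <= rgraph_prob H p no_isolated.
Proof.
move=> p01 H1; rewrite !rgraph_probE; apply: le_expect => // F _.
have := connected_no_isolated (F := F) H1; case: connected_graph => [->|] //.
Qed.

Lemma prob_connected_ge p (M : R) : 0 <= p <= 1 ->
  rgraph_prob H p no_isolated <= rgraph_prob H p connected_graph
    + \sum_(v : H) \sum_(s < #|H|.+1 | [&& (1 < s)%N, (2 * s <= #|H|)%N & s%:R < M])
        expect p (edges H) (fun F => (#|comp F v| == s)%:R)
    + expect p (edges H) (fun F => ([exists S : {set H},
        ((M <= #|S|%:R) && (2 * #|S| <= #|H|)%N) && [disjoint cut S & F]])%:R).
Proof.
move=> p01; rewrite !rgraph_probE.
under eq_bigr => v _ do rewrite -expect_sum.
rewrite -expect_sum -!expectD; apply: le_expect => // F _.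
exact: disconnected_cases.
Qed.

End Components.

(** * Estimates for one graph *)

Lemma expR_powE (R : realType) (x : R) (m : nat) :
  expR x ^+ m = expR (x * m%:R).
Proof. by rewrite -expRM_natl mulrC. Qed.

Lemma sum_ord_lt (m n : nat) : (\sum_(s < m) (s < n) = minn m n)%N.
Proof.
elim: m => [|m IH]; first by rewrite big_ord0 min0n.
by rewrite big_ord_recr /= IH; case: (ltnP m n) => /= ?; lia.
Qed.

Lemma sum_split_le (R : realType) (m n : nat) (P : pred nat) (f : nat -> R)
    (y A B : R) :
    y <= n%:R -> 0 <= A -> 0 <= B ->
    (forall s, P s -> s%:R < y -> f s <= A) ->
    (forall s, P s -> y <= s%:R -> f s <= B) ->
  \sum_(s < m | P s) f s <= n%:R * A + m%:R * B.
Proof.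
move=> yn A0 B0 fA fB.
apply: (@le_trans _ _ (\sum_(s < m) ((s < n)%N%:R * A + B))).
  rewrite big_mkcond /=; apply: ler_sum => s _.
  have AB0 : 0 <= (s < n)%N%:R * A + B by rewrite addr_ge0 ?mulr_ge0.
  case: ifP => // Ps; have [sy|sy] := ltP (s%:R) y.
    have -> : (s < n)%N by rewrite -(ltr_nat R); apply: lt_le_trans yn.
    by rewrite mul1r -[leLHS]addr0 lerD // fA.
  by rewrite -[leLHS]add0r lerD ?mulr_ge0 // fB.
rewrite big_split /= -mulr_suml -natr_sum sum_ord_lt.
have -> : \sum_(s < m) B = m%:R * B by rewrite sumr_const card_ord mulr_natl.
rewrite lerD2r.
by rewrite ler_wpM2r // ler_nat geq_minr.
Qed.

(** All quantities are measured on a logarithmic scale: [1 - p = exp (- a)],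
    [N = exp l] and [n = exp L]. The number [y] separates small sets, whose
    boundary is estimated with the minimum degree, from those to which the
    isoperimetric condition applies; it will be [n ^ (1 - e)]. The hypotheses from
    [y_le] to [n_L] only say that [n] is large, except for [eps_C], which fixes
    the exponent [C] in the threshold [M = N / n ^ C] for large sets. *)
Section Estimates.
Import mathcomp.boot.fintype mathcomp.boot.finset Pilot.Defs.
Local Close Scope classical_set_scope.

Context {R : realType} {H : sgraph}.
Variables (n c C : nat) (p a y L l eps : R).
Local Notation N := (#|H|%:R : R).
Local Notation delta := ((min_degree H)%:R : R).
Local Notation Delta := ((max_degree H)%:R : R).
Local Notation lam := (\sum_(v : H) (1 - p) ^+ degree v).
Hypothesis pE : 1 - p = expR (- a).
Hypothesis a0 : 0 < a.
Hypothesis NE : N = expR l.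
Hypothesis nE : n%:R = expR L.
Hypothesis L1 : 1 <= L.
Hypothesis l0 : 0 < l.
Hypothesis eps0 : 0 < eps.
Hypothesis y0 : 0 < y.
Hypothesis aDelta : l / 2 <= a * Delta.
Hypothesis delta_ge : n%:R <= delta.
Hypothesis Delta_y : Delta <= delta * y.
Hypothesis Delta_le : Delta <= expR (c%:R * L).
Hypothesis boundary_hyp : forall s : nat, y <= s%:R -> s%:R <= N / 2 ->
  eps * Delta * s%:R * (1 - ln s%:R / l) <= (min_boundary H s)%:R.
Hypothesis y_le : y <= n%:R / 2.
Hypothesis y_ge : 48 / eps <= y.
Hypothesis y_l : (2 * c%:R + C%:R + 3) * L <= l / (8 * y).
Hypothesis eps_C : 4 * (2 * c%:R + 1) <= eps * C%:R.
Hypothesis L_l : 2 * c%:R * L <= eps * l / 16.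
Hypothesis l_exp : 3 * l <= expR (l / 2).
Hypothesis l_L : (2 * C%:R + 2) * L <= l.
Hypothesis n_eps : 8 / eps <= n%:R.
Hypothesis n_L : L <= eps / 8 * ln 2 * n%:R.

Let p01 : 0 <= p <= 1.
Proof.
have -> : p = 1 - expR (- a) by rewrite -pE; ring.
by rewrite subr_ge0 gerBl expR_ge0 andbT expR_le1 oppr_le0 ltW.
Qed.

(** The edge probability in each of the two rounds: an edge is missing with
    probability [sqrt (1 - p)]. *)
Let p1 : R := 1 - expR (- (a / 2)).

Let p1E : 1 - p1 = expR (- (a / 2)).
Proof. by rewrite /p1; ring. Qed.

Let p101 : 0 <= p1 <= 1.
Proof.
by rewrite /p1 subr_ge0 gerBl expR_ge0 andbT expR_le1 oppr_le0 divr_ge0 // ltW.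
Qed.

Let cL0 : 0 <= c%:R * L.
Proof. by rewrite mulr_ge0 // (le_trans _ L1). Qed.

Let CL0 : 0 <= C%:R * L.
Proof. by rewrite mulr_ge0 // (le_trans _ L1). Qed.

Let M : R := expR (l - C%:R * L).

(** The minimum degree is large enough for [q ^ delta] to beat the powers of [n]
    that occur below. *)
Let adelta : 4 * (2 * c%:R + C%:R + 3) * L <= a * delta.
Proof.
have h : l / 2 <= a * delta * y.
  by apply: le_trans aDelta _; rewrite -mulrA ler_wpM2l // ltW.
have : l / (2 * y) <= a * delta.
  by rewrite invfM mulrA ler_pdivrMr.
apply: le_trans; have -> : l / (2 * y) = 4 * (l / (8 * y)).
  by field; rewrite gt_eqF.
by rewrite -mulrA ler_wpM2l.
Qed.

(** A small set has fewer than [delta / 2] vertices. The vertex [v] is treated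
    apart, because the factor [q ^ d(v)] has to be kept: its sum over [v] is
    bounded, while [N q ^ delta] need not be. *)
Lemma boundary_small (v : H) (S : {set H}) : v \in S -> #|S|%:R < y ->
  (degree v)%:R + #|S|.-1%:R * (delta / 2) <= (boundary S)%:R.
Proof.
move=> vS Sy; have := boundary_ge S.
rewrite (bigD1 v) //= => bS.
have h1 : (#|S|.-1 * min_degree H <= \sum_(u in S | u != v) degree u)%N.
  rewrite (cardsD1 v) vS /= -sum_nat_const.
  rewrite [leqRHS](eq_bigl (fun u => u \in S :\ v)); last first.
    by move=> u; rewrite !inE andbC.
  by apply: leq_sum => u _; apply: min_degree_le.
have {bS}h1 : (degree v + #|S|.-1 * min_degree H <=
    boundary S + #|S| * #|S|.-1)%N.
  by apply: leq_trans bS; rewrite leq_add2l.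
have h2 : (degree v)%:R + #|S|.-1%:R * delta <=
    (boundary S)%:R + #|S|%:R * #|S|.-1%:R :> R.
  by rewrite -!natrM -!natrD ler_nat.
have h3 : #|S|%:R <= delta / 2.
  apply/ltW; apply: lt_le_trans Sy _; apply: le_trans y_le _.
  by rewrite ler_pM2r.
have h4 : 0 <= #|S|.-1%:R :> R by [].
by nra.
Qed.

(** The isoperimetric condition with [a Delta >= l / 2]; in terms of [q] it reads
    [q ^ b(S) <= (#|S| / N) ^ (eps #|S| / 2)]. *)
Lemma boundary_large (S : {set H}) : y <= #|S|%:R -> #|S|%:R <= N / 2 ->
  eps / 2 * #|S|%:R * (l - ln #|S|%:R) <= a * (boundary S)%:R.
Proof.
move=> yS SN.
have S0 : 0 < #|S|%:R :> R by apply: lt_le_trans yS.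
have bmin : (min_boundary H #|S| <= boundary S)%N.
  by apply: (@bigminn_le _ _ (fun S' : {set H} => #|S'| == #|S|));
    rewrite ?mem_index_enum.
have lnS : ln #|S|%:R <= l.
  rewrite -[l]expRK ler_ln ?posrE ?expR_gt0 // -NE.
  by apply: le_trans SN _; rewrite ler_pdivrMr // mulrDr mulr1 lerDl.
apply: (@le_trans _ _ (a * (eps * Delta * #|S|%:R * (1 - ln #|S|%:R / l)))); last first.
  rewrite ler_pM2l //; apply: le_trans (boundary_hyp yS SN) _.
  by rewrite ler_nat.
have -> : eps / 2 * #|S|%:R * (l - ln #|S|%:R) =
    l / 2 * (eps * #|S|%:R * (1 - ln #|S|%:R / l)) by field; rewrite gt_eqF.
have -> : a * (eps * Delta * #|S|%:R * (1 - ln #|S|%:R / l)) =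
    a * Delta * (eps * #|S|%:R * (1 - ln #|S|%:R / l)) by ring.
apply: ler_wpM2r => //; apply: mulr_ge0; first by rewrite mulr_ge0 // ltW.
by rewrite subr_ge0 ler_pdivrMr // mul1r.
Qed.

Lemma prob_comp_size_expR (p' a' z : R) (v : H) (s : nat) :
    0 <= p' <= 1 -> 1 - p' = expR (- a') ->
    (forall S : {set H}, v \in S -> #|S| = s -> z <= a' * (boundary S)%:R) ->
  expect p' (edges H) (fun F => (#|comp F v| == s)%:R) <=
  expR (2 * c%:R * L * s.-1%:R - z).
Proof.
move=> p'01 p'E zS.
apply: le_trans (prob_comp_size p'01 (t := expR (- z)) _ _) _.
- exact: expR_ge0.
- by move=> S vS cS; rewrite p'E expR_powE ler_expR mulNr lerN2 zS.
rewrite expRD ler_wpM2r ?expR_ge0 //.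
apply: (@le_trans _ _ (expR (c%:R * L) ^+ (2 * s.-1))).
  by rewrite lerXn2r ?nnegrE ?expR_ge0.
by rewrite expR_powE ler_expR natrM; suff -> : 2 * c%:R * L * s.-1%:R = c%:R * L * (2%:R * s.-1%:R) by []; ring.
Qed.

Lemma small_comp_prob (v : H) (s : nat) : (1 < s)%N -> s%:R < y ->
  expect p (edges H) (fun F => (#|comp F v| == s)%:R) <=
  (1 - p) ^+ degree v * expR (- ((C%:R + 3) * L)).
Proof.
move=> s1 sy.
apply: le_trans (prob_comp_size_expR
  (z := a * ((degree v)%:R + s.-1%:R * (delta / 2))) p01 pE _) _.
  by move=> S vS cS; rewrite ler_pM2l // -cS boundary_small // cS.
rewrite pE expR_powE -expRD ler_expR.
have h1 : 1 <= s.-1%:R :> R by rewrite ler1n; case: s s1 {sy} => [|[]].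
have ad := adelta; have cL := cL0; have CL := CL0; have L1' := L1.
have h2 : (C%:R + 3) * L <= a * delta / 2 - 2 * c%:R * L by lra.
have h3 : 0 <= (C%:R + 3) * L by lra.
by nra.
Qed.

Lemma small_comp_prob_half (v : H) (s : nat) : (0 < s)%N -> s%:R < y ->
  expect p1 (edges H) (fun F => (#|comp F v| == s)%:R) <=
  expR (- ((C%:R + 3) * L)).
Proof.
move=> s1 sy.
apply: le_trans (prob_comp_size_expR
  (z := a / 2 * (s%:R * (delta / 2))) p101 p1E _) _.
  move=> S vS cS; rewrite ler_pM2l ?divr_gt0 //.
  apply: le_trans (boundary_small vS _); rewrite cS //.
  have : (min_degree H <= degree v)%N by apply: min_degree_le.
  rewrite -(ler_nat R) => h.
  have d0 : 0 <= delta by [].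
  by rewrite -{1}(prednK s1) -natr1 mulrDl mul1r addrC lerD2r; nra.
rewrite ler_expR.
have h1 : 1 <= s%:R :> R by rewrite ler1n.
have h1' : s.-1%:R <= s%:R :> R by rewrite ler_nat leq_pred.
have ad := adelta; have cL := cL0; have CL := CL0; have L1' := L1.
have h2 : (C%:R + 3) * L <= a * delta / 4 - 2 * c%:R * L by lra.
have h3 : 0 <= (C%:R + 3) * L by lra.
have h4 : 2 * c%:R * L * s.-1%:R <= 2 * c%:R * L * s%:R.
  by rewrite ler_wpM2l // !mulr_ge0 //; lra.
by nra.
Qed.

(** If [s <= sqrt N], then [(s / N) ^ (eps s / 4)] is at most a power
    [N ^ (- eps s / 8)], which suffices as [s >= y] is a large constant. If
    [sqrt N < s < M], the base [(s / N) ^ (eps / 4)] still compensates [Delta ^ 2],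
    with a factor [1 / n] to spare, and [s] itself exceeds [3 ln N]. *)
Lemma mid_comp_prob (p' a' : R) (v : H) (s : nat) :
    0 <= p' <= 1 -> 1 - p' = expR (- a') -> a / 2 <= a' ->
    y <= s%:R -> s%:R <= N / 2 -> s%:R < M ->
  expect p' (edges H) (fun F => (#|comp F v| == s)%:R) <= expR (- (3 * l)).
Proof.
move=> p'01 p'E a'E ys sN sM.
have s0 : 0 < s%:R :> R by apply: lt_le_trans ys.
apply: le_trans (prob_comp_size_expR
  (z := eps / 4 * s%:R * (l - ln s%:R)) p'01 p'E _) _.
  move=> S vS cS; have := @boundary_large S; rewrite cS => /(_ ys sN) h.
  apply: (@le_trans _ _ (a / 2 * (boundary S)%:R)); last exact: ler_wpM2r.
  by lra.
have c0 : 0 <= c%:R :> R by [].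
have C0 : 0 <= C%:R :> R by [].
rewrite ler_expR.
have h1' : s.-1%:R <= s%:R :> R by rewrite ler_nat leq_pred.
have h4 : 2 * c%:R * L * s.-1%:R <= 2 * c%:R * L * s%:R.
  by rewrite ler_wpM2l // !mulr_ge0 //; have := L1; lra.
suff : 3 * l <= s%:R * (eps / 4 * (l - ln s%:R) - 2 * c%:R * L) by lra.
have [ls|ls] := leP (ln s%:R) (l / 2).
  have h : eps * l / 16 <= eps / 4 * (l - ln s%:R) - 2 * c%:R * L.
    have : eps / 4 * (l / 2) <= eps / 4 * (l - ln s%:R).
      by rewrite ler_pM2l ?divr_gt0 //; lra.
    by have := L_l; lra.
  apply: (@le_trans _ _ (48 / eps * (eps * l / 16))).
    by rewrite le_eqVlt; apply/orP; left; apply/eqP; field; rewrite gt_eqF.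
  apply: ler_pM => //.
  - by rewrite divr_ge0 // ltW.
  - by rewrite divr_ge0 // mulr_ge0 // ltW.
  - exact: le_trans ys.
have lsM : ln s%:R <= l - C%:R * L.
  by rewrite -[leRHS]expRK ler_ln ?posrE ?expR_gt0 // ltW.
have h : 1 <= eps / 4 * (l - ln s%:R) - 2 * c%:R * L.
  have : eps / 4 * (C%:R * L) <= eps / 4 * (l - ln s%:R).
    by rewrite ler_pM2l ?divr_gt0 //; lra.
  have : 4 * (2 * c%:R + 1) * L <= eps * C%:R * L.
    by apply: ler_wpM2r eps_C; have := L1; lra.
  by have := L1; lra.
have sl : 3 * l <= s%:R.
  apply: le_trans l_exp _.
  by rewrite -[leRHS]lnK ?posrE // ler_expR ltW.
by nra.
Qed.

Let expNL : expR (- L) = n%:R^-1.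
Proof. by rewrite expRN nE. Qed.

Let y_le_n : y <= n%:R.
Proof. by apply: le_trans y_le _; rewrite ler_pdivrMr // mulrDr mulr1 lerDl. Qed.

Let two_le_n : 2 <= n%:R :> R.
Proof. by rewrite nE; apply: le_trans (expR_ge1Dx _); have := L1; lra. Qed.

Let M_le : M <= N / 2.
Proof.
have C1 : 1 <= C%:R :> R.
  rewrite ler1n lt0n; apply/eqP => C_eq0; have := eps_C; rewrite C_eq0 mulr0.
  by have : 0 <= c%:R :> R by []; lra.
rewrite /M NE expRD ler_pM2l ?expR_gt0 // expRN lef_pV2 ?posrE ?expR_gt0 //.
apply: le_trans (expR_ge1Dx _); have := L1.
by have : 1 * L <= C%:R * L; [rewrite ler_wpM2r //; have := L1; lra | lra].
Qed.

Let N_gt0 : 0 < N. Proof. by rewrite NE expR_gt0. Qed.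

Let L_le_l : (C%:R + 1) * L <= l /\ L <= l.
Proof. by have := l_L; have := CL0; have := L1; split; lra. Qed.

Let tail_sum : N * (#|H|.+1%:R * expR (- (3 * l))) <= 2 * expR (- l).
Proof.
have -> : expR (- (3 * l)) = N^-1 * N^-1 * expR (- l).
  by rewrite NE -!expRN -!expRD; congr expR; ring.
rewrite -natr1.
have N1 : 1 <= N by rewrite NE; apply: le_trans (expR_ge1Dx _); have := l0; lra.
have -> : N * ((N + 1) * (N^-1 * N^-1 * expR (- l))) = (1 + N^-1) * expR (- l).
  by field; rewrite gt_eqF.
rewrite ler_wpM2r ?expR_ge0 // -[leRHS]/(1 + 1) lerD2l invf_le1 //.
Qed.

Let sumN (x : R) : N * x = \sum_(v : H) x.
Proof. by rewrite sumr_const mulr_natl. Qed.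

Let lam_ge0 : 0 <= lam.
Proof. by apply: sumr_ge0 => v _; rewrite pE exprn_ge0 ?expR_ge0. Qed.

(** Markov's inequality for the number of components after the first round. It is
    at most [B = M / n] with high probability: the expected number of vertices in
    components smaller than [M] is at most about [N / n ^ (C + 2) = B / n], and
    there are at most [N / M = n ^ C] other components. *)
Lemma many_components_le :
  expect p1 (edges H) (fun F => #|comps F|%:R) / (M * n%:R^-1) <= 4 / n%:R.
Proof.
have M0 : 0 < M by apply: expR_gt0.
apply: (@le_trans _ _ ((N * (n%:R * expR (- ((C%:R + 3) * L)) +
    #|H|.+1%:R * expR (- (3 * l)) + M^-1)) / (M * n%:R^-1))).
  rewrite ler_pM2r ?invr_gt0 ?mulr_gt0 ?invr_gt0 //; last by rewrite nE expR_gt0.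
  apply: le_trans (expect_comps_le _ p101 M0) _.
  rewrite sumN; apply: ler_sum => v _; rewrite lerD2r.
  apply: (@sum_split_le R #|H|.+1 n (fun s => (0 < s)%N && (s%:R < M))
    (fun s => expect p1 (edges H) (fun F => (#|comp F v| == s)%:R)) y) => //.
  - by move=> s /andP[s0 _]; apply: small_comp_prob_half.
  move=> s /andP[s0 sM] ys; apply: (mid_comp_prob _ p101 p1E) => //.
  by apply: le_trans M_le; apply: ltW.
have -> : N * (n%:R * expR (- ((C%:R + 3) * L)) + #|H|.+1%:R * expR (- (3 * l))
    + M^-1) / (M * n%:R^-1) =
  N * (n%:R * expR (- ((C%:R + 3) * L))) / (M * n%:R^-1) +
  (N * (#|H|.+1%:R * expR (- (3 * l)))) / (M * n%:R^-1) +
  N * M^-1 / (M * n%:R^-1) by ring.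
have V : (M * n%:R^-1)^-1 = expR ((C%:R + 1) * L - l).
  by rewrite -expNL -expRD -expRN; congr expR; ring.
have e1 : N * (n%:R * expR (- ((C%:R + 3) * L))) / (M * n%:R^-1) = n%:R^-1.
  by rewrite V -expNL nE NE -!expRD; congr expR; ring.
have e2 : N * (#|H|.+1%:R * expR (- (3 * l))) / (M * n%:R^-1) <= 2 * n%:R^-1.
  rewrite V; apply: (@le_trans _ _ (2 * expR (- l) * expR ((C%:R + 1) * L - l))).
    by rewrite ler_wpM2r ?expR_ge0 //; apply: tail_sum.
  rewrite -mulrA ler_pM2l // -expRD -expNL ler_expR.
  by have [] := L_le_l; have := L1; lra.
have e3 : N * M^-1 / (M * n%:R^-1) <= n%:R^-1.
  rewrite V -expNL NE -expRN -!expRD ler_expR.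
  by have := l_L; lra.
lra.
Qed.

Let prob_connected_lower :
  expR (- (lam / (1 - n%:R^-1))) <=
  rgraph_prob H p connected_graph + (lam + 7) / n%:R.
Proof.
have M0 : 0 < M by apply: expR_gt0.
have n0 : 0 < n%:R :> R by rewrite nE expR_gt0.
apply: (@le_trans _ _ (rgraph_prob H p no_isolated)).
  apply: prob_no_isolated_ge => //.
    by rewrite invf_lt1 //; apply: lt_le_trans two_le_n; lra.
  move=> v; rewrite pE expR_powE -expNL ler_expR mulNr lerN2.
  apply: (@le_trans _ _ (a * delta)); last first.
    by rewrite ler_pM2l // ler_nat min_degree_le.
  by have := adelta; have := cL0; have := CL0; have := L1; lra.
apply: le_trans (prob_connected_ge H M p01) _.
rewrite -addrA lerD2l.
have -> : (lam + 7) / n%:R = (lam / n%:R + 2 * n%:R^-1) + (4 / n%:R + n%:R^-1) by ring.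
apply: lerD.
  apply: (@le_trans _ _ (\sum_(v : H) (n%:R * ((1 - p) ^+ degree v *
      expR (- ((C%:R + 3) * L))) + #|H|.+1%:R * expR (- (3 * l))))).
    apply: ler_sum => v _.
    apply: (@sum_split_le R #|H|.+1 n
      (fun s => [&& (1 < s)%N, (2 * s <= #|H|)%N & s%:R < M])
      (fun s => expect p (edges H) (fun F => (#|comp F v| == s)%:R)) y) => //.
    - by apply: mulr_ge0; rewrite ?expR_ge0 // pE exprn_ge0 ?expR_ge0.
    - by move=> s /and3P[s1 _ _]; apply: small_comp_prob.
    move=> s /and3P[s0 _ sM] ys; apply: (mid_comp_prob _ p01 pE) => //.
      by have := a0; lra.
    by apply: le_trans M_le; apply: ltW.
  rewrite big_split /=; apply: lerD.
    rewrite -mulr_sumr -mulr_suml mulrCA ler_wpM2l //.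
    rewrite -expNL nE -expRD ler_expR.
    by have := CL0; have := L1; lra.
  rewrite -sumN; apply: le_trans tail_sum _.
  rewrite ler_pM2l // -expNL ler_expR lerN2.
  by have [] := L_le_l.
apply: le_trans (prob_separated_le (p1 := p1) (B := M * n%:R^-1)
  (t := expR (- (eps / 4 * M * ln 2))) p101 _ _ (expR_ge0 _) _) _.
- by rewrite pE p1E -expRD; congr expR; field.
- by apply: mulr_gt0 => //; rewrite invr_gt0.
- move=> S /andP[MS S2]; rewrite p1E expR_powE ler_expR mulNr lerN2.
  have S0 : 0 < #|S|%:R :> R by apply: lt_le_trans MS.
  have SN : #|S|%:R <= N / 2.
    by rewrite ler_pdivlMr // mulrC -natrM ler_nat.
  have yS : y <= #|S|%:R.
    apply: le_trans y_le_n _; apply: le_trans MS; rewrite nE ler_expR.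
    by have [] := L_le_l; have := L1; lra.
  have lnS : ln 2 <= l - ln #|S|%:R.
    rewrite lerBrDl -lnM ?posrE // -[leRHS]expRK -NE ler_ln ?posrE ?mulr_gt0 //.
    by rewrite -ler_pdivlMr.
  have := boundary_large yS SN.
  have ln20 : 0 <= ln 2 :> R by rewrite ln_ge0 // ler1n.
  (* As [M <= #|S| <= N / 2]. *)
  have : M * ln 2 <= #|S|%:R * (l - ln #|S|%:R) by apply: ler_pM => //; apply: ltW.
  have e4 : 0 <= eps / 4 by rewrite divr_ge0 // ltW.
  move=> /(ler_wpM2l e4); lra.
rewrite lerD //; first exact: many_components_le.
(* The number [2 ^ (M / n)] of candidates is negligible against the gain
   [2 ^ (- eps M / 4)], because [1 / n <= eps / 8]. *)
rewrite /powR ifF; last by apply/negbTE; rewrite pnatr_eq0.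
rewrite -expRD -[leRHS]expNL ler_expR.
have ln20 : 0 <= ln 2 :> R by rewrite ln_ge0 // ler1n.
have nM : n%:R <= M.
  by rewrite nE ler_expR; have [] := L_le_l; lra.
have neps : n%:R^-1 <= eps / 8.
  by rewrite -[leRHS]invrK lef_pV2 ?posrE ?invr_gt0 ?divr_gt0 // invf_div.
have h1 : M * ln 2 * n%:R^-1 <= M * ln 2 * (eps / 8).
  by apply: ler_wpM2l => //; apply: mulr_ge0 => //; apply: ltW.
have h2 : n%:R * (ln 2 * (eps / 8)) <= M * (ln 2 * (eps / 8)).
  by apply: ler_wpM2r => //; rewrite mulr_ge0 // divr_ge0 // ltW.
by have := n_L; lra.
Qed.

Let prob_connected_upper :
  rgraph_prob H p connected_graph <= expR (- ((1 - n%:R^-1) * lam)).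
Proof.
have n0 : 0 < n%:R :> R by rewrite nE expR_gt0.
apply: le_trans (prob_connected_le p01 _) _.
  rewrite -(ltr_nat R) NE; apply: lt_le_trans (expR_ge1Dx _).
  by have := l0; lra.
apply: prob_no_isolated_le => //; last first.
  by rewrite invf_le1 //; apply: le_trans two_le_n; lra.
apply: (@le_trans _ _ (expR (c%:R * L) * expR (- (a * delta / 2)))).
  apply: ler_pM => //; first by rewrite pE exprn_ge0 ?expR_ge0.
  rewrite pE expR_powE ler_expR mulNr lerN2.
  rewrite -mulrA ler_pM2l //.
  have d2 : 2 <= delta by apply: le_trans two_le_n delta_ge.
  have d0 : (0 < min_degree H)%N.
    by rewrite -(ltr_nat R); apply: lt_le_trans d2; lra.
  have -> : (min_degree H).-1%:R = delta - 1.
    by rewrite -[in RHS](prednK d0) -natr1 addrK.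
  by lra.
rewrite -expRD -expNL ler_expR.
by have := adelta; have := cL0; have := CL0; have := L1; lra.
Qed.

(** The error [(lam + 7) / n] collects [lam / n] from the small components, [2 / n]
    from the middle ones, [4 / n] from [many_components_le], and [1 / n] from the
    second round. *)
Theorem prob_connected_estimate :
  expR (- (lam / (1 - n%:R^-1))) - (lam + 7) / n%:R <=
    rgraph_prob H p connected_graph <= expR (- ((1 - n%:R^-1) * lam)).
Proof. by rewrite lerBlDr prob_connected_lower prob_connected_upper. Qed.

End Estimates.

(** * The limit *)

Lemma ln_nat_eventually_ge (R : realType) (K : R) :
  \forall n \near \oo, K <= ln (n%:R : R).
Proof.
near=> n; have h : expR K <= n%:R by near: n; exact: nbhs_infty_ger.
by rewrite -[K]expRK ler_ln ?posrE ?expR_gt0 // (lt_le_trans (expR_gt0 K)).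
Unshelve. all: by end_near. Qed.

Lemma expR_ge_sqr (R : realType) (x : R) : 0 <= x -> x ^+ 2 / 2 <= expR x.
Proof.
move=> x0; apply: le_trans (expR_ge1Dxn 1 x0).
by rewrite (_ : 2`!%:R = 2 :> R) // lerDr.
Qed.

Lemma expR_ge_id (R : realType) (x : R) : x <= expR x.
Proof. by apply: le_trans (expR_ge1Dx x); rewrite lerDr. Qed.

Theorem theorem1 (R : realType) (k : nat) (G : nat -> sgraph)
    (lambda_ : nat -> R) (lambda : R) (p : nat -> R) :
  (2 <= k)%N ->
  (forall n : nat, (1 <= n)%N -> connected_graph (G n)) ->
  basic_conditions R k G ->
  lambda_ @ \oo --> lambda ->
  0 < lambda ->
  (\forall n \near \oo,
     0 < p n < 1 /\
     rgraph_expect (G n) (p n) (fun H => (num_isolated H)%:R) = lambda_ n) ->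
  (fun n => rgraph_prob (G n) (p n) connected_graph) @ \oo
    --> expR (- lambda).
Proof.
move=> k2 _ [eps' [c [eps [eps'0 eps0 cond]]]] cvl lambda0 hp.
(* Decreasing [eps'] weakens the hypotheses; with [e <= 1 / 2] the threshold
   [n ^ (1 - e)] tends to infinity, even if [eps' >= 1]. *)
pose e : R := Num.min eps' (1 / 2).
have e0 : 0 < e by rewrite lt_min eps'0 divr_gt0.
have e_eps' : e <= eps' by rewrite ge_min lexx.
have e12 : e <= 1 / 2 by rewrite ge_min lexx orbT.
have [C _ hC] := nbhs_infty_ger (4 * (2 * c%:R + 1) / eps).
have {hC} eps_C : 4 * (2 * c%:R + 1) <= eps * C%:R.
  by rewrite [leRHS]mulrC -ler_pdivrMr //; apply: hC => /=.
have k0 : 0 < k%:R :> R by rewrite ltr0n; apply: leq_trans k2.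
have lnk0 : 0 < ln k%:R :> R by rewrite ln_gt0 // ltr1n.
have ln20 : 0 < ln 2 :> R by rewrite ln_gt0 // ltr1n.
have inv0 : (fun n : nat => (n%:R : R)^-1) @ \oo --> (0 : R).
  apply/gtr0_cvgV0; last exact: cvgr_idn.
  by near=> n; rewrite ltr0n; near: n; exact: nbhs_infty_gt.
pose lower n := expR (- (lambda_ n / (1 - n%:R^-1))) - (lambda_ n + 7) / n%:R.
pose upper n := expR (- ((1 - n%:R^-1) * lambda_ n)).
have cv1 : (fun n : nat => 1 - (n%:R : R)^-1) @ \oo --> (1 : R).
  by rewrite -[X in _ --> X]subr0; apply: cvgB => //; apply: cvg_cst.
have cv_lower : lower @ \oo --> expR (- lambda).
  rewrite -[X in _ --> X]subr0; apply: cvgB.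
    apply: continuous_cvg; first exact: continuous_expR.
    apply: cvgN; rewrite -[X in _ --> X]mulr1; apply: cvgM => //.
    by rewrite -[X in _ --> X]invr1; apply: cvgV => //; rewrite oner_eq0.
  rewrite -[X in _ --> X](mulr0 (lambda + 7)); apply: cvgM => //.
  by apply: cvgD => //; apply: cvg_cst.
have cv_upper : upper @ \oo --> expR (- lambda).
  apply: continuous_cvg; first exact: continuous_expR.
  by apply: cvgN; rewrite -[X in _ --> X]mul1r; apply: cvgM.
apply: (squeeze_cvgr _ cv_lower cv_upper).
have lam_le : \forall n \near \oo, lambda_ n <= lambda + 1.
  by apply: (cvgr_le lambda) => //; rewrite ltrDl.
have large := @ln_nat_eventually_ge R.
near=> n.
have [[/andP[p0 p1] lamE] [cardG min_n maxmin max_nc bd]] :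
    (0 < p n < 1 /\ rgraph_expect (G n) (p n) (fun H => (num_isolated H)%:R) =
      lambda_ n) /\
    [/\ #|G n| = (k ^ n)%N, (n <= min_degree (G n))%N,
        (max_degree (G n))%:R / (min_degree (G n))%:R
          <= (n%:R : R) `^ (1 - eps'),
        (max_degree (G n) <= n ^ c)%N &
        forall s : nat, (n%:R : R) `^ (1 - eps') <= s%:R ->
          s%:R <= (k%:R ^+ n / 2 : R) ->
          eps * (max_degree (G n))%:R * s%:R
            * (1 - n%:R^-1 * (ln s%:R / ln k%:R))
          <= (min_boundary (G n) s)%:R].
  by split; near: n.
set L : R := ln n%:R.
(* Every requirement on the size of [n] is a lower bound for [L = ln n]. *)
have L_ge1 : 1 <= L by rewrite /L; near: n; exact: large.
have L_y2 : e^-1 <= L by rewrite /L; near: n; exact: large.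
have L_yge : 96 / eps <= L by rewrite /L; near: n; exact: large.
have L_yl : 16 * (2 * c%:R + C%:R + 3) / (e ^+ 2 * ln k%:R) <= L.
  by rewrite /L; near: n; exact: large.
have L_Ll : 64 * c%:R / (eps * ln k%:R) <= L by rewrite /L; near: n; exact: large.
have L_lexp : 24 / ln k%:R <= L by rewrite /L; near: n; exact: large.
have L_lL : 2 * (2 * C%:R + 2) / ln k%:R <= L by rewrite /L; near: n; exact: large.
have L_neps : 8 / eps <= L by rewrite /L; near: n; exact: large.
have L_nL : 16 / (eps * ln 2) <= L by rewrite /L; near: n; exact: large.
have L_lam : 2 * ln (lambda + 1) / ln k%:R <= L by rewrite /L; near: n; exact: large.
have L0 : 0 < L by apply: lt_le_trans L_ge1.
have n0 : 0 < n%:R :> R.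
  by rewrite ltr0n lt0n; apply: contraTneq L0; rewrite /L => ->; rewrite ln0 ?ltxx.
have nE : n%:R = expR L by rewrite lnK.
have n_sqr : L ^+ 2 / 2 <= n%:R by rewrite nE; apply: expR_ge_sqr; apply: ltW.
have nL : L <= n%:R by rewrite nE; apply: expR_ge_id.
set l : R := n%:R * ln k%:R.
have l0 : 0 < l by rewrite mulr_gt0.
have l_ge : L * ln k%:R <= l by rewrite ler_pM2r.
have NE : #|G n|%:R = expR l :> R.
  by rewrite cardG natrX /l expRM_natl lnK.
set a : R := - ln (1 - p n).
have q0 : 0 < 1 - p n by rewrite subr_gt0.
have pE : 1 - p n = expR (- a) by rewrite /a opprK lnK.
have a0 : 0 < a by rewrite /a oppr_gt0 ln_lt0 // q0 gtrBl.
pose y : R := expR ((1 - e) * L).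
have y0 : 0 < y by apply: expR_gt0.
have powy : (n%:R : R) `^ (1 - eps') <= y.
  rewrite /powR ifF; last by apply/negbTE; rewrite gt_eqF.
  by rewrite -/L ler_expR ler_pM2r // lerD2l lerN2.
have y_exp : n%:R = y * expR (e * L).
  by rewrite nE /y -expRD; congr expR; ring.
have eL_ge1 : 1 <= e * L by rewrite -ler_pdivrMl // mulr1.
have l_sqr : L ^+ 2 / 2 * ln k%:R <= l by rewrite ler_pM2r.
have lam_sum : lambda_ n = \sum_(v : G n) (1 - p n) ^+ degree v.
  by rewrite -lamE expect_num_isolated.
have delta_ge : n%:R <= (min_degree (G n))%:R :> R by rewrite ler_nat.
have delta0 : 0 < (min_degree (G n))%:R :> R by apply: lt_le_trans delta_ge.
rewrite /lower /upper lam_sum.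
apply: (@prob_connected_estimate R (G n) n c C (p n) a y L l eps) => //.
(* [N q ^ Delta <= lambda + 1 <= sqrt N]. *)
- have : expR (l - a * (max_degree (G n))%:R) <= expR (l / 2).
    apply: (@le_trans _ _ (lambda_ n)).
      rewrite lam_sum expRD -NE -sumr_const mulr_suml; apply: ler_sum => v _.
      rewrite mul1r pE expR_powE ler_expR -mulNr ler_wnM2l ?oppr_le0 ?(ltW a0) //.
      by rewrite ler_nat max_degree_ge.
    apply: (@le_trans _ _ (lambda + 1)); first by near: n.
    rewrite -[leLHS]lnK ?posrE ?addr_gt0 // ler_expR ler_pdivlMr // mulrC.
    by apply: le_trans l_ge; rewrite -ler_pdivrMr.
  by rewrite ler_expR; lra.
- by rewrite mulrC -ler_pdivrMr //; apply: le_trans powy.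
- by rewrite expRM_natl -nE -natrX ler_nat.
- move=> s ys sN; have := bd s (le_trans powy ys).
  rewrite -natrX -cardG => /(_ sN); congr (_ * (1 - _) <= _).
  by rewrite /l; field; rewrite !gt_eqF.
- rewrite ler_pdivlMr // y_exp ler_pM2l //.
  by apply: le_trans (expR_ge1Dx _); lra.
- apply: le_trans (expR_ge_id _); apply: (@le_trans _ _ (1 / 2 * L)).
    by move: L_yge; lra.
  by rewrite ler_pM2r //; lra.
- have -> : l / (8 * y) = ln k%:R / 8 * expR (e * L).
    by rewrite /l y_exp; field; rewrite gt_eqF.
  apply: (@le_trans _ _ (ln k%:R / 8 * ((e * L) ^+ 2 / 2))); last first.
    rewrite ler_pM2l ?divr_gt0 //; apply: expR_ge_sqr.
    by rewrite mulr_ge0 // ltW.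
  move: L_yl; rewrite ler_pdivrMr ?mulr_gt0 ?exprn_gt0 // => h.
  by move: (ler_wpM2r (ltW L0) h); lra.
- move: L_Ll; rewrite ler_pdivrMr ?mulr_gt0 // => h.
  have := ler_wpM2r (ltW L0) h; have := ler_wpM2l (ltW eps0) l_sqr; lra.
- apply: (@le_trans _ _ ((l / 2) ^+ 2 / 2)); last first.
    by apply: expR_ge_sqr; rewrite divr_ge0 // ltW.
  have h : 24 <= l by apply: le_trans l_ge; rewrite -ler_pdivrMr.
  by have := ler_wpM2r (ltW l0) h; lra.
- move: L_lL; rewrite ler_pdivrMr // => h.
  by have := ler_wpM2r (ltW L0) h; lra.
- exact: le_trans nL.
- move: L_nL; rewrite ler_pdivrMr ?mulr_gt0 // => h.
  have := ler_wpM2r (ltW L0) h.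
  have := ler_wpM2l (ltW (mulr_gt0 eps0 ln20)) n_sqr; lra.
Unshelve. all: by end_near. Qed.
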